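(* Let $\sigma>0$, $\alpha>0$, and let $F:\mathcal{P}(\mathcal{X})\times\mathcal{P}(\mathcal{Y})\to\mathbb{R}$ satisfy the following three assumptions. (1) (Convexity-concavity) $F$ admits first order flat derivatives with respect to both $\nu$ and $\mu$, and for all $\nu,\nu'\in\mathcal{P}(\mathcal{X})$, $\mu,\mu'\in\mathcal{P}(\mathcal{Y})$, $$F(\nu',\mu)-F(\nu,\mu)\ge\int_{\mathcal{X}}\frac{\delta F}{\delta\nu}(\nu,\mu,x)(\nu'-\nu)(\mathrm{d}x),\qquad F(\nu,\mu')-F(\nu,\mu)\le\int_{\mathcal{Y}}\frac{\delta F}{\delta\mu}(\nu,\mu,y)(\mu'-\mu)(\mathrm{d}y).$$ (2) There exist $C_\nu,C_\mu>0$ such that $\left|\frac{\delta F}{\delta\nu}(\nu,\mu,x)\right|\le C_\nu$ and $\left|\frac{\delta F}{\delta\mu}(\nu,\mu,y)\right|\le C_\mu$ for all $(\nu,\mu)\in\mathcal{P}(\mathcal{X})\times\mathcal{P}(\mathcal{Y})$ and $(x,y)\in\mathcal{X}\times\mathcal{Y}$. (3) $F$ admits second order flat derivatives and there exist $C_{\nu,\nu},C_{\mu,\mu},C_{\nu,\mu},C_{\mu,\nu}>0$ such that $\left|\frac{\delta^2F}{\delta\nu^2}(\nu,\mu,x,x')\right|\le C_{\nu,\nu}$, $\left|\frac{\delta^2F}{\delta\mu^2}(\nu,\mu,y,y')\right|\le C_{\mu,\mu}$, $\left|\frac{\delta^2F}{\delta\nu\delta\mu}(\nu,\mu,y,x)\right|\le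 C_{\nu,\mu}$, $\left|\frac{\delta^2F}{\delta\mu\delta\nu}(\nu,\mu,x,y)\right|\le C_{\mu,\nu}$ for all $(\nu,\mu)\in\mathcal{P}(\mathcal{X})\times\mathcal{P}(\mathcal{Y})$ and $(x,y),(x',y')\in\mathcal{X}\times\mathcal{Y}$. Let $(\nu_t,\mu_t)_{t\ge0}$ be the mean-field best response (MF-BR) flow with initial condition $(\nu_0,\mu_0)\in\mathcal{P}_{\mathrm{ac}}(\mathcal{X})\times\mathcal{P}_{\mathrm{ac}}(\mathcal{Y})$. Then the map $t\mapsto\operatorname{D_{KL}}(\nu_t|\Psi_\sigma(\nu_t,\mu_t))+\operatorname{D_{KL}}(\mu_t|\Phi_\sigma(\nu_t,\mu_t))$ is differentiable for all $t>0$, and $$\frac{\mathrm{d}}{\mathrm{d}t}\Big(\operatorname{D_{KL}}(\nu_t|\Psi_\sigma(\nu_t,\mu_t))+\operatorname{D_{KL}}(\mu_t|\Phi_\sigma(\nu_t,\mu_t))\Big)\le-\alpha\Big(\operatorname{D_J}(\nu_t,\Psi_\sigma(\nu_t,\mu_t))+\operatorname{D_J}(\mu_t,\Phi_\sigma(\nu_t,\mu_t))\Big).$$ Furthermore, suppose that $(\nu_0,\mu_0)\in\mathcal{P}_{\mathrm{ac}}(\mathcal{X})\times\mathcal{P}_{\mathrm{ac}}(\mathcal{Y})$ are chosen such that $\operatorname{D_{KL}}(\nu_0|\Psi_\sigma(\nu_0,\mu_0))+\operatorname{D_{KL}}(\mu_0|\Phi_\sigma(\nu_0,\mu_0))<\infty$,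 and let $(\nu^*_\sigma,\mu^*_\sigma)$ be the mixed Nash equilibrium of the game with payoff $V^\sigma$. Then $$\operatorname{D_{KL}}(\nu_t|\Psi_\sigma(\nu_t,\mu_t))+\operatorname{D_{KL}}(\mu_t|\Phi_\sigma(\nu_t,\mu_t))\le e^{-\alpha t}\Big(\operatorname{D_{KL}}(\nu_0|\Psi_\sigma(\nu_0,\mu_0))+\operatorname{D_{KL}}(\mu_0|\Phi_\sigma(\nu_0,\mu_0))\Big),$$ $$\operatorname{NI}(\nu_t,\mu_t)\le\frac{\sigma^2}{2}e^{-\alpha t}\Big(\operatorname{D_{KL}}(\nu_0|\Psi_\sigma(\nu_0,\mu_0))+\operatorname{D_{KL}}(\mu_0|\Phi_\sigma(\nu_0,\mu_0))\Big).$$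
   Context: Setting. $\mathcal{X},\mathcal{Y}\subseteq\mathbb{R}^d$; $U^\pi:\mathcal{X}\to\mathbb{R}$ and $U^\rho:\mathcal{Y}\to\mathbb{R}$ are measurable with $\int_{\mathcal{X}}e^{-U^\pi(x)}\mathrm{d}x=\int_{\mathcal{Y}}e^{-U^\rho(y)}\mathrm{d}y=1$; $\pi(x)=e^{-U^\pi(x)}$, $\rho(y)=e^{-U^\rho(y)}$. $\mathcal{P}(\mathcal{Z})$ is the set of probability measures on $\mathcal{Z}$ and $\mathcal{P}_{\mathrm{ac}}(\mathcal{Z})$ the subset of those absolutely continuous with respect to Lebesgue measure; a measure and its density are denoted by the same symbol. $\operatorname{D_{KL}}(m|m')=\int\log\left(\frac{m(x)}{m'(x)}\right)m(x)\,\mathrm{d}x$ is the relative entropy, and $\operatorname{D_J}(m,m')=\operatorname{D_{KL}}(m|m')+\operatorname{D_{KL}}(m'|m)$ is Jeffreys divergence. Flat derivatives. For $\mathcal{M}\subseteq\mathbb{R}^d$, $G:\mathcal{P}(\mathcal{M})\to\mathbb{R}$ admits a first order flat derivative if there is $\frac{\delta G}{\delta m}:\mathcal{P}(\mathcal{M})\times\mathcal{M}\to\mathbb{R}$, jointly continuous (weak topology on $\mathcal{P}(\mathcal{M})$), such that for each $m$ the function $\frac{\delta G}{\delta m}(m,\cdot)$ is bounded and, for all $m,m'$, $G(m')-G(m)=\int_0^1\int_{\mathcal{M}}\frac{\delta G}{\delta m}(m+\varepsilon(m'-m),x)(m'-m)(\mathrm{d}x)\mathrm{d}\varepsilon$;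 it is normalized by $\int_{\mathcal{M}}\frac{\delta G}{\delta m}(m,x)m(\mathrm{d}x)=0$. For $F$ on $\mathcal{P}(\mathcal{X})\times\mathcal{P}(\mathcal{Y})$, $\frac{\delta F}{\delta\nu}(\nu,\mu,x)$ and $\frac{\delta F}{\delta\mu}(\nu,\mu,y)$ are the flat derivatives in the first and second argument. Second order flat derivatives are flat derivatives of first order ones with the point fixed: $\frac{\delta^2F}{\delta\nu^2}(\nu,\mu,x,\cdot)$ and $\frac{\delta^2F}{\delta\mu\delta\nu}(\nu,\mu,x,\cdot)$ are the flat derivatives in $\nu$, resp. $\mu$, of $\frac{\delta F}{\delta\nu}(\nu,\mu,x)$; $\frac{\delta^2F}{\delta\mu^2}(\nu,\mu,y,\cdot)$ and $\frac{\delta^2F}{\delta\nu\delta\mu}(\nu,\mu,y,\cdot)$ are those in $\mu$, resp. $\nu$, of $\frac{\delta F}{\delta\mu}(\nu,\mu,y)$. Game. $V^\sigma(\nu,\mu)=F(\nu,\mu)+\frac{\sigma^2}{2}(\operatorname{D_{KL}}(\nu|\pi)-\operatorname{D_{KL}}(\mu|\rho))$. A mixed Nash equilibrium (MNE) is a pair $(\nu^*_\sigma,\mu^*_\sigma)\in\mathcal{P}_{\mathrm{ac}}(\mathcal{X})\times\mathcal{P}_{\mathrm{ac}}(\mathcal{Y})$ with $V^\sigma(\nu^*_\sigma,\mu)\le V^\sigma(\nu^*_\sigma,\mu^*_\sigma)\le V^\sigma(\nu,\mu^*_\sigma)$ for all $(\nu,\mu)\in\mathcal{P}(\mathcal{X})\times\mathcal{P}(\mathcal{Y})$.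 The Nikaidò–Isoda error is $\operatorname{NI}(\nu,\mu)=\max_{\mu'\in\mathcal{P}(\mathcal{Y})}V^\sigma(\nu,\mu')-\min_{\nu'\in\mathcal{P}(\mathcal{X})}V^\sigma(\nu',\mu)$. Best responses. $\Psi_\sigma(\nu,\mu)$ and $\Phi_\sigma(\nu,\mu)$ are the probability measures on $\mathcal{X}$, $\mathcal{Y}$ with densities $$\Psi_\sigma(\nu,\mu)(x)=\tfrac{1}{Z(\nu,\mu)}\exp\left(-\tfrac{2}{\sigma^2}\tfrac{\delta F}{\delta\nu}(\nu,\mu,x)-U^\pi(x)\right),\quad\Phi_\sigma(\nu,\mu)(y)=\tfrac{1}{Z'(\nu,\mu)}\exp\left(\tfrac{2}{\sigma^2}\tfrac{\delta F}{\delta\mu}(\nu,\mu,y)-U^\rho(y)\right),$$ where $Z,Z'$ are normalizing constants. MF-BR flow. With learning rate $\alpha>0$, it is the unique flow $(\nu_t,\mu_t)_{t\ge0}$ in $\mathcal{P}_{\mathrm{ac}}(\mathcal{X})\times\mathcal{P}_{\mathrm{ac}}(\mathcal{Y})$ with the given initial condition satisfying, for $t\ge0$, $\mathrm{d}\nu_t(x)=\alpha(\Psi_\sigma(\nu_t,\mu_t)(x)-\nu_t(x))\mathrm{d}t$ and $\mathrm{d}\mu_t(y)=\alpha(\Phi_\sigma(\nu_t,\mu_t)(y)-\mu_t(y))\mathrm{d}t$ (existence and uniqueness hold under assumptions (2) and (3)).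
   Formalization: The mixed second order flat derivatives are assumed jointly continuous in both measures and the new point (without this differentiability can fail), and differentiability with its inequality is claimed only at times t>0 where the sum of relative entropies is finite. *)

(* Defs.v *)
From HB Require Import structures.
From mathcomp Require Import all_boot all_order all_algebra.
From mathcomp Require Import all_classical all_reals all_analysis.
From mathcomp Require Import measurable_realfun.

Set Implicit Arguments.
Unset Strict Implicit.
Unset Printing Implicit Defensive.

Import Order.TTheory GRing.Theory Num.Theory.
Import numFieldNormedType.Exports.

Local Open Scope classical_set_scope.
Local Open Scope ring_scope.

Definition rV_display : measure_display. Proof. by constructor. Qed.

Section borel_rV.
Context (R : realType) (d : nat).

Definition rV_borel : set (set 'rV[R]_d) := <<s @open 'rV[R]_d >>.

Let rV_borel0 : rV_borel set0.
Proof. exact: sigma_algebra0. Qed.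

Let rV_borelC A : rV_borel A -> rV_borel (~` A).
Proof. exact: sigma_algebraC. Qed.

Let rV_borel_bigcup (F : (set 'rV[R]_d)^nat) :
  (forall i, rV_borel (F i)) -> rV_borel (\bigcup_i F i).
Proof. exact: sigma_algebra_bigcup. Qed.

HB.instance Definition _ := @isMeasurable.Build rV_display 'rV[R]_d
  rV_borel rV_borel0 rV_borelC rV_borel_bigcup.

Lemma rV_borelE : @measurable _ 'rV[R]_d = <<s @open 'rV[R]_d >>.
Proof. by []. Qed.

Lemma measurable_coord (i : 'I_d) :
  measurable_fun [set: 'rV[R]_d] (fun v : 'rV[R]_d => v ord0 i).
Proof.
apply: (measurability _ (RGenOpens.measurableE R)).
move=> _ [_ [a [b ->]] <-]; rewrite setTI.
apply: sub_sigma_algebra.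
apply: open_comp; last exact: interval_open.
by move=> x _; exact: coord_continuous.
Qed.

Lemma measurable_rVP e (T : measurableType e) (f : T -> 'rV[R]_d) :
  (forall i, measurable_fun [set: T] (fun x => f x ord0 i)) ->
  measurable_fun [set: T] f.
Proof.
move=> mf; apply: (measurability _ rV_borelE).
move=> _ [U oU <-]; rewrite setTI.
pose box (q : d.-tuple rat * rat) : set 'rV[R]_d :=
  [set v | forall i, `|ratr (tnth q.1 i) - v ord0 i| < ratr q.2].
have -> : U = \bigcup_(q in [set q | box q `<=` U]) box q.
  apply/seteqP; split => [v Uv|v [q /= qU]]; last exact: qU.
  have /nbhs_ballP[e0 /= e0_gt0 e0U] : nbhs v U by exact: open_nbhs_nbhs.
  have [r /andP[r0 re]] : exists r : rat, 0 < (ratr r : R) < e0 / 2.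
    have /rat_in_itvoo[r] : (0 : R) < e0 / 2 by rewrite divr_gt0.
    by rewrite in_itv/= => /andP[r0 re]; exists r; rewrite r0.
  have /choice[q qP] : forall i, exists q : rat, `|ratr q - v ord0 i| < ratr r.
    move=> i; have /rat_in_itvoo[q] : v ord0 i - ratr r < v ord0 i + ratr r.
      by rewrite ltrBlDr -addrA ltrDl addr_gt0.
    by rewrite in_itv/= -ltr_distlC distrC => qr; exists q.
  exists ([tuple q i | i < d], r); last by move=> i /=; rewrite tnth_mktuple.
  move=> w /= wq; apply: e0U; split => // i j; rewrite !ord1.
  have := wq j; rewrite tnth_mktuple => wqj.
  rewrite /ball/= (le_lt_trans (ler_distD (ratr (q j)) _ _))//.
  rewrite (splitr e0) ltrD//; last exact: lt_trans re.
  by rewrite distrC (lt_trans (qP j)).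
rewrite preimage_bigcup bigcup_mkcond.
apply: countable_bigcupT_measurable => // q.
case: ifP => // _.
rewrite (_ : _ @^-1` _ = \bigcap_(i in [set: 'I_d])
    (fun x => f x ord0 i) @^-1` (ball (ratr (tnth q.1 i) : R) (ratr q.2 : R))); last first.
  by apply/seteqP; split => [x /= bx i _|x /= bx i]; exact: bx.
apply: fin_bigcap_measurable => // i _.
rewrite -[X in measurable X]setTI; apply: mf => //.
exact: measurable_ball.
Qed.

End borel_rV.

Section rV_cons.
Context (R : realType) (n : nat).

Definition rV_cons (z : measurableTypeR R * 'rV[R]_n) : 'rV[R]_n.+1 :=
  \row_i (if unlift ord0 i is Some j then z.2 ord0 j else z.1).

Definition rV_uncons (v : 'rV[R]_n.+1) : measurableTypeR R * 'rV[R]_n :=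
  (v ord0 ord0, \row_j v ord0 (lift ord0 j)).

Lemma rV_consK : cancel rV_cons rV_uncons.
Proof.
move=> [x v]; rewrite /rV_uncons !mxE unlift_none; congr pair.
by apply/rowP => j; rewrite !mxE liftK.
Qed.

Lemma measurable_rV_cons : measurable_fun [set: (measurableTypeR R * 'rV[R]_n)%type] rV_cons.
Proof.
apply: measurable_rVP => i; rewrite /rV_cons.
under eq_fun do rewrite mxE.
case: unliftP => [j _|_]; last exact: measurable_fst.
exact: (measurableT_comp (@measurable_coord R n j) measurable_snd).
Qed.

Lemma measurable_rV_uncons : measurable_fun [set: 'rV[R]_n.+1] rV_uncons.
Proof.
apply: measurable_fun_pair; first exact: measurable_coord.
apply: measurable_rVP => j; under eq_fun do rewrite mxE.
exact: measurable_coord.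
Qed.

End rV_cons.

Section lebesgue_rV_succ.
Context (R : realType) (n : nat).
Variable m : {sigma_finite_measure set 'rV[R]_n -> \bar R}.

Definition lebesgue_rV_succ : set 'rV[R]_n.+1 -> \bar R :=
  pushforward (@lebesgue_measure R \x m)%E (@rV_cons R n).

HB.instance Definition _ := Measure.copy lebesgue_rV_succ
  (measure_function_pushforward__canonical__measure_function_Measure
     (@lebesgue_measure R \x m)%E (@measurable_rV_cons R n)).

Let lebesgue_rV_succ_sigma_finite : sigma_finite setT lebesgue_rV_succ.
Proof.
have /sigma_finiteP[F [TF ndF Foo]] := sigma_finiteT (@lebesgue_measure R).
have /sigma_finiteP[G [TG ndG Goo]] := sigma_finiteT m.
exists (fun k => @rV_uncons R n @^-1` (F k `*` G k)).
  rewrite -preimage_bigcup (_ : \bigcup_k (F k `*` G k) = setT) ?preimage_setT//.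
  apply/seteqP; split => // -[x y] _.
  have [i _ Fx] : (\bigcup_k F k) x by rewrite -TF.
  have [j _ Gy] : (\bigcup_k G k) y by rewrite -TG.
  exists (maxn i j) => //; split.
    by move: x Fx; exact/subsetPset/ndF/leq_maxl.
  by move: y Gy; exact/subsetPset/ndG/leq_maxr.
move=> k; have [mF Fkoo] := Foo k; have [mG Gkoo] := Goo k; split.
  rewrite -[X in measurable X]setTI; apply: measurable_rV_uncons => //.
  exact: measurableX.
rewrite /lebesgue_rV_succ /pushforward -comp_preimage.
rewrite (_ : _ \o _ = id); last by apply/funext => z /=; rewrite rV_consK.
by rewrite product_measure1E// lte_mul_pinfty// ge0_fin_numE.
Qed.

HB.instance Definition _ := Measure_isSigmaFinite.Build _ _ _
  lebesgue_rV_succ lebesgue_rV_succ_sigma_finite.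

End lebesgue_rV_succ.

Fixpoint lebesgue_rV (R : realType) (n : nat) :
    {sigma_finite_measure set 'rV[R]_n -> \bar R} :=
  match n with
  | 0%N => \d_(0 : 'rV[R]_0)
  | k.+1 => lebesgue_rV_succ (lebesgue_rV R k)
  end.

Lemma measurable_rV_box (R : realType) (n : nat) (a b : 'I_n -> R) :
  measurable [set v : 'rV[R]_n | forall i, a i <= v ord0 i <= b i].
Proof.
rewrite (_ : [set _ | _] = \bigcap_(i in [set: 'I_n])
    (fun v : 'rV[R]_n => v ord0 i) @^-1` `[a i, b i]).
  apply: fin_bigcap_measurable => // i _.
  by rewrite -[X in measurable X]setTI; exact: measurable_coord.
apply/seteqP; split => [v /= vab i _|v /= vab i]; first by rewrite /preimage/= in_itv/=.
by have := vab i I; rewrite /preimage/= in_itv/=.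
Qed.

Lemma lebesgue_rV_box (R : realType) (n : nat) (a b : 'I_n -> R) :
  (forall i, a i <= b i) ->
  lebesgue_rV R n [set v | forall i, a i <= v ord0 i <= b i] =
  (\prod_(i < n) (b i - a i))%:E.
Proof.
elim: n a b => [|n IH] a b ab.
  by rewrite big_ord0 /= diracE mem_set// => -[].
rewrite big_ord_recl EFinM -(IH _ _ (fun i => ab (lift ord0 i))).
rewrite /= /lebesgue_rV_succ /pushforward.
rewrite (_ : _ @^-1` _ = `[a ord0, b ord0] `*`
  [set v : 'rV[R]_n | forall i, a (lift ord0 i) <= v ord0 i <= b (lift ord0 i)]).
  rewrite product_measure1E//; last exact: measurable_rV_box.
  congr (_ * _)%E; rewrite [LHS](@lebesgue_measure_itv R `[a ord0, b ord0]).
  rewrite /= lte_fin lt_neqAle ab andbT -EFinB.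
  by case: eqVneq => [->|]; rewrite ?subrr.
apply/seteqP; split => [[x v] /= xv|[x v] /= [xab vab] i].
  split; first by have := xv ord0; rewrite !mxE unlift_none in_itv.
  by move=> i; have := xv (lift ord0 i); rewrite !mxE liftK.
rewrite mxE; case: unliftP => [j ->|->]; first exact: vab.
by move: xab; rewrite in_itv.
Qed.

Section prob_on.
Context (R : realType) (d : nat) (X : set 'rV[R]_d).

Record prob_on := ProbOn {
  prob_on_val :> probability 'rV[R]_d R ;
  prob_on1 : prob_on_val X = 1%E }.

HB.instance Definition _ := gen_eqMixin prob_on.
HB.instance Definition _ := gen_choiceMixin prob_on.

Definition bounded_on (f : 'rV[R]_d -> R) :=
  exists C, forall x, X x -> `|f x| <= C.

Definition test_fun : Type :=
  {f : 'rV[R]_d -> R | {within X, continuous f} /\ bounded_on f}.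

Definition test_integral (m : prob_on) : {ptws test_fun -> R} :=
  fun f => \int[m]_(x in X) sval f x.

HB.instance Definition _ :=
  Topological.copy prob_on (initial_topology test_integral).

End prob_on.

Section mixture.
Context (R : realType) (d : nat) (X : set 'rV[R]_d).

Definition clamp01 (e : R) : R := Num.max 0 (Num.min e 1).

Lemma clamp01_ge0 e : 0 <= clamp01 e.
Proof. by rewrite /clamp01 le_max lexx. Qed.

Lemma clamp01_le1 e : 0 <= 1 - clamp01 e.
Proof. by rewrite subr_ge0 /clamp01 ge_max ler01 ge_min lexx orbT. Qed.

Lemma clamp01_id e : 0 <= e <= 1 -> clamp01 e = e.
Proof.
by move=> /andP[e0 e1]; rewrite /clamp01 (min_idPl e1) (max_idPr e0).
Qed.

Section mix_measure.
Variables (e : R) (m m' : prob_on X).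

Definition mix_measure : set 'rV[R]_d -> \bar R :=
  measure_add (mscale (NngNum (clamp01_le1 e)) m)
              (mscale (NngNum (clamp01_ge0 e)) m').

HB.instance Definition _ := Measure.on mix_measure.

Lemma mix_measureE A :
  mix_measure A = ((1 - clamp01 e)%:E * m A + (clamp01 e)%:E * m' A)%E.
Proof. by rewrite /mix_measure measure_addE. Qed.

Let mix_measureT : mix_measure setT = 1%E.
Proof. by rewrite mix_measureE !probability_setT !mule1 -EFinD subrK. Qed.

HB.instance Definition _ :=
  Measure_isProbability.Build _ _ _ mix_measure mix_measureT.

Lemma mix_measure1 : mix_measure X = 1%E.
Proof. by rewrite mix_measureE !prob_on1 !mule1 -EFinD subrK. Qed.

(* the measure [m + e (m' - m)], for [0 <= e <= 1] *)
Definition mix : prob_on X := ProbOn mix_measure1.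

End mix_measure.

End mixture.

Section flat_derivative.
Context (R : realType) (d : nat) (M : set 'rV[R]_d).

(* the integral of [f] with respect to the signed measure [m' - m] *)
Definition int_diff (m m' : prob_on M) (f : 'rV[R]_d -> R) : R :=
  \int[m']_(x in M) f x - \int[m]_(x in M) f x.

(* The left-hand side of the third clause being finite, the equation also says
   that the integral over [0, 1] converges. *)
Definition flat_derivative (G : prob_on M -> R)
    (dG : prob_on M -> 'rV[R]_d -> R) :=
  [/\ {within [set z : prob_on M * 'rV[R]_d | M z.2],
        continuous (fun z => dG z.1 z.2)},
      forall m, bounded_on M (dG m),
      forall m m', (G m' - G m)%:E =
        (\int[lebesgue_measure]_(e in `[0%R, 1%R])
          (int_diff m m' (dG (mix e m m')))%:E)%E &
      forall m : prob_on M, \int[m]_(x in M) dG m x = 0].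

End flat_derivative.

Section relative_entropy.
Context (R : realType) (d : nat) (M : set 'rV[R]_d).
Implicit Types p q : 'rV[R]_d -> R.
Local Open Scope charge_scope.
Local Notation leb := (lebesgue_rV R d).

Definition KL p q : \bar R :=
  if `[< {ae leb, forall x, M x -> q x = 0 -> p x = 0} >]
  then (\int[leb]_(x in M) (p x * ln (p x / q x))%:E)%E
  else +oo%E.

Definition Jeffreys p q : \bar R := (KL p q + KL q p)%E.

Definition abs_cont (m : prob_on M) := m `<< leb.

Definition density (m : prob_on M) (x : 'rV[R]_d) : R :=
  fine (('d (charge_of_finite_measure m) '/d leb) x).

(* relative entropy of an arbitrary measure with respect to a density *)
Definition KLm (m : prob_on M) q : \bar R :=
  if `[< abs_cont m >] then KL (density m) q else +oo%E.

Definition is_density (m : prob_on M) p :=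
  [/\ measurable_fun M p, forall x, M x -> 0 <= p x &
      forall A, measurable A -> A `<=` M ->
        m A = (\int[leb]_(x in A) (p x)%:E)%E].

Definition is_potential (U : 'rV[R]_d -> R) :=
  measurable_fun M U /\ (\int[leb]_(x in M) (expR (- U x))%:E = 1)%E.

Definition normalized p x : R := (\int[leb]_(z in M) p z)^-1 * p x.

End relative_entropy.

Section game.
Context (R : realType) (d : nat) (X Y : set 'rV[R]_d).
Variables (sigma : R) (Upi Urho : 'rV[R]_d -> R).
Variable F : prob_on X -> prob_on Y -> R.
Variables dF_nu dF_mu : prob_on X -> prob_on Y -> 'rV[R]_d -> R.

Definition first_flat_derivatives :=
  (forall mu, flat_derivative (F ^~ mu) (dF_nu ^~ mu)) /\
  (forall nu, flat_derivative (F nu) (dF_mu nu)).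

(* In [d2F_ab nu mu z z'], [z] is the argument of the first order derivative.
   The mixed derivatives are taken in both measures and their joint continuity
   accordingly involves both. *)
Definition second_flat_derivatives
    (d2F_nunu d2F_munu d2F_mumu d2F_numu :
       prob_on X -> prob_on Y -> 'rV[R]_d -> 'rV[R]_d -> R) :=
  [/\ forall mu x, X x ->
        flat_derivative (fun nu => dF_nu nu mu x) (fun nu => d2F_nunu nu mu x),
      forall nu y, Y y ->
        flat_derivative (fun mu => dF_mu nu mu y) (fun mu => d2F_mumu nu mu y),
      forall x, X x ->
        (forall nu,
          flat_derivative (fun mu => dF_nu nu mu x)
                          (fun mu => d2F_munu nu mu x)) /\
        {within [set z : prob_on X * prob_on Y * 'rV[R]_d | Y z.2],
          continuous (fun z => d2F_munu z.1.1 z.1.2 x z.2)} &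
      forall y, Y y ->
        (forall mu,
          flat_derivative (fun nu => dF_mu nu mu y)
                          (fun nu => d2F_numu nu mu y)) /\
        {within [set z : prob_on X * prob_on Y * 'rV[R]_d | X z.2],
          continuous (fun z => d2F_numu z.1.1 z.1.2 y z.2)}].

Definition convex_concave :=
  (forall nu nu' mu,
     F nu' mu - F nu mu >= int_diff nu nu' (dF_nu nu mu)) /\
  (forall nu mu mu',
     F nu mu' - F nu mu <= int_diff mu mu' (dF_mu nu mu)).

(* [oo - oo] is [-oo] here; it occurs only if both relative entropies are
   infinite, and then no value of [payoff] affects [is_MNE], nor [NI] at a pair
   with finite relative entropies. *)
Definition payoff (nu : prob_on X) (mu : prob_on Y) : \bar R :=
  ((F nu mu)%:E + (sigma ^+ 2 / 2)%:E *
    (KLm nu (fun x => expR (- Upi x)) - KLm mu (fun y => expR (- Urho y))))%E.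

Definition is_MNE (nus : prob_on X) (mus : prob_on Y) :=
  [/\ abs_cont nus, abs_cont mus &
      forall nu mu, (payoff nus mu <= payoff nus mus <= payoff nu mus)%E].

Definition NI (nu : prob_on X) (mu : prob_on Y) : \bar R :=
  (ereal_sup (range (fun mu' => payoff nu mu')) -
   ereal_inf (range (fun nu' => payoff nu' mu)))%E.

Definition Psi (nu : prob_on X) (mu : prob_on Y) : 'rV[R]_d -> R :=
  normalized X (fun x => expR (- (2 / sigma ^+ 2) * dF_nu nu mu x - Upi x)).

Definition Phi (nu : prob_on X) (mu : prob_on Y) : 'rV[R]_d -> R :=
  normalized Y (fun y => expR (2 / sigma ^+ 2 * dF_mu nu mu y - Urho y)).

(* derivative at [t] of a function on [0, +oo[, one-sided at [t = 0] *)
Definition derivative_ge0 (f : R -> R) (t l : R) :=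
  (f s - f t) / (s - t) @[s --> within [set s | 0 <= s] t^'] --> l.

Definition MFBR_flow (alpha : R) (nu : R -> prob_on X) (mu : R -> prob_on Y) :=
  exists n m : R -> 'rV[R]_d -> R, forall t, 0 <= t ->
    [/\ is_density (nu t) (n t), is_density (mu t) (m t),
        forall x, X x -> derivative_ge0 (n ^~ x) t
          (alpha * (Psi (nu t) (mu t) x - n t x)) &
        forall y, Y y -> derivative_ge0 (m ^~ y) t
          (alpha * (Phi (nu t) (mu t) y - m t y))].

Definition KL_to_BR (nu : prob_on X) (mu : prob_on Y) : \bar R :=
  (KL X (density nu) (Psi nu mu) + KL Y (density mu) (Phi nu mu))%E.

Definition Jeffreys_to_BR (nu : prob_on X) (mu : prob_on Y) : \bar R :=
  (Jeffreys X (density nu) (Psi nu mu) +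
   Jeffreys Y (density mu) (Phi nu mu))%E.

End game.

(* Main.v *)
(* Write [Q] for the best response of one player, of density proportional to
   [exp (g - U)], where [g] is the flat derivative of the payoff scaled by
   [-+ 2 / sigma^2], and [n] for the density of this player along the flow.  The
   bounds on [g] give [k e^(-U) <= Q <= K e^(-U)], so the equation
   [n' = alpha (Q - n)] makes [exp (alpha t) (n - k e^(-U))] nondecreasing and
   [exp (alpha t) (n - K e^(-U))] nonincreasing.  Hence, at [t > 0], [n] is
   bounded below by a multiple of [e^(-U)] and [|n_s - n_t| <= D |s - t| n_t],
   which dominates the difference quotients of [n ln (n / Q)] by a multiple of
   [n_t (1 + |ln (n_t / Q_t)|)].  The second order flat derivatives only serve to
   make [g] Lipschitz and differentiable in time.  Dominated convergence gives
     d/dt KL(n | Q) = - alpha J(n, Q) + alpha^-1 int g' n'.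
   Summed over the two players, the last term is the limit of
   [int (g_s - g_t) (n_s - n_t) / (s - t)^2], which is nonpositive because
   convexity-concavity makes the pair of first order derivatives a monotone
   operator.
   Since [KL <= J], [exp (alpha t) KL] is nonincreasing on [t > 0], and convexity
   of the relative entropy controls its limit at [0].  Finally, the Gibbs
   variational principle bounds the gain of any deviation of a player by
   [sigma^2 / 2] times the relative entropy to the best response. *)
Require Import Defs.
From mathcomp Require Import all_boot all_order all_algebra.
From mathcomp Require Import all_classical all_reals all_analysis.
From mathcomp Require Import measurable_realfun ring lra.

Set Implicit Arguments.
Unset Strict Implicit.
Unset Printing Implicit Defensive.

Import Order.TTheory GRing.Theory Num.Theory.
Import numFieldNormedType.Exports.

Local Open Scope classical_set_scope.
Local Open Scope ring_scope.

(** * Real-valued integrals and dominated convergence *)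

(** Two features of the computation are not visible in the final formula. The normalizing constant
    of [Q] moves with time; its logarithmic derivative is the mean of [g'] under [Q]. Since [n] has
    mass 1, this turns [- int g' n] into [- int g' (n - Q)], which is [alpha^-1 int g' n'], a
    pairing of two velocities. Its sign is read off second order difference quotients, so that
    convexity-concavity is used in its first order form and no symmetry of the mixed second order
    derivatives has to be established. A flat derivative expresses an increment as an average over a
    segment of measures. A mean value theorem replaces the average by one mixture, with a parameter
    over which there is no control. Mixtures stay on the segment, hence converge weakly to its fixed
    end whatever the parameter, and continuity of the derivative can be applied there. All estimates
    at a time [t > 0] are relative to [n t]: the finiteness of the entropy at [t] is then enough to
    dominate its increments. *)

Section real_integrable.
Context {d} {T : measurableType d} {R : realType}.
Variables (mu : {measure set T -> \bar R}) (D : set T).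
Hypothesis mD : measurable D.
Implicit Types f g h : T -> R.
Local Notation integ f := (mu.-integrable D (EFin \o f)).

Lemma integ_measurable f : integ f -> measurable_fun D f.
Proof. by move=> /measurable_int /measurable_EFinP. Qed.

Lemma integD f g : integ f -> integ g -> integ (fun x => f x + g x).
Proof. by move=> fi gi; exact: (integrableD mD fi gi). Qed.

Lemma integB f g : integ f -> integ g -> integ (fun x => f x - g x).
Proof. by move=> fi gi; exact: (integrableB mD fi gi). Qed.

Lemma integZ c f : integ f -> integ (fun x => c * f x).
Proof. by move=> fi; exact: (integrableZl mD c fi). Qed.

Lemma integ_norm f : integ f -> integ (fun x => `|f x|).
Proof. by move=> fi; exact: (integrable_abse fi). Qed.

Lemma le_integ f g : measurable_fun D f -> (forall x, D x -> `|f x| <= g x) ->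
  integ g -> integ f.
Proof.
move=> mf fg gi; apply: le_integrable gi => //; first exact/measurable_EFinP.
by move=> x Dx /=; rewrite lee_fin (le_trans (fg _ Dx))// ler_norm.
Qed.

Lemma integM_bounded C h f : measurable_fun D h ->
  (forall x, D x -> `|h x| <= C) -> integ f -> integ (fun x => h x * f x).
Proof.
move=> mh hC fi; apply: (@le_integ _ (fun x => C * `|f x|)).
- by apply: measurable_funM => //; exact: integ_measurable.
- by move=> x Dx; rewrite normrM ler_wpM2r// hC.
- exact/integZ/integ_norm.
Qed.

(** The minorant [g] makes the integral of the negative part finite, so an infinite positive part
    would force the integral of [f] to be [+oo]. Meant for entropies, which have an integrable
    minorant but no a priori majorant. *)
Lemma integral_fin_integ f g : measurable_fun D f -> integ g ->
  (forall x, D x -> g x <= f x) ->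
  (\int[mu]_(x in D) (f x)%:E < +oo)%E -> integ f.
Proof.
move=> mf gi gf foo.
have fneg_le x : D x -> ((EFin \o f)^\- x <= `|(g x)%:E|)%E.
  move=> Dx; rewrite funenegE -EFin_max lee_fin ge_max normr_ge0 andbT.
  by have := ler_norm (- g x); rewrite normrN; have := gf _ Dx; lra.
have mEf : measurable_fun D (EFin \o f) by exact/measurable_EFinP.
have fneg_fin : (\int[mu]_(x in D) (EFin \o f)^\- x < +oo)%E.
  case/integrableP : gi => mg; apply: le_lt_trans; apply: ge0_le_integral => //.
  - exact: measurable_funeneg.
  - exact: measurableT_comp.
apply/integrableP; split => //.
rewrite -/(abse \o (EFin \o f)) fune_abse.
rewrite ge0_integralD//; [|exact: measurable_funepos|exact: measurable_funeneg].
rewrite lte_add_pinfty//.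
move: foo; rewrite integralE; case: (\int[mu]_(x in D) _^\+ x)%E => [r|//|//].
- by rewrite ltry.
- have : (0 <= \int[mu]_(x in D) (EFin \o f)^\- x)%E by exact: integral_ge0.
  by move: fneg_fin; case: (\int[mu]_(x in D) _^\- x)%E.
Qed.

(** Reduction to dominated convergence along sequences avoiding [t]. Integrability of [l],
    measurability included, is a conclusion: time derivatives known only as pointwise limits then
    need no separate argument. *)
Lemma dominated_cvg_dnbhs (t : R) (f : R -> T -> R) (l g : T -> R) :
  (\forall s \near t^', measurable_fun D (f s) /\
     forall x, D x -> `|f s x| <= g x) ->
  integ g -> (forall x, D x -> f s x @[s --> t^'] --> l x) ->
  integ l /\ \int[mu]_(x in D) f s x @[s --> t^'] --> \int[mu]_(x in D) l x.
Proof.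
move=> fg gi fl.
have main (u : R^nat) : (forall n, u n != t) /\ u n @[n --> \oo] --> t ->
    integ l /\ \int[mu]_(x in D) f (u n) x @[n --> \oo] --> \int[mu]_(x in D) l x.
  move=> [ut u_cvg].
  (* The domination holds only near [t], hence the shift by [N]. *)
  have [N _ HN] : \forall n \near \oo, measurable_fun D (f (u n)) /\
      forall x, D x -> `|f (u n) x| <= g x.
    case: fg => r /= r0 fg; move/cvgrPdist_lt : u_cvg => /(_ _ r0)[N _ HN].
    by exists N => // n Nn; apply: fg => //=; exact: HN.
  have fuP n : measurable_fun D (f (u (n + N)%N)) /\
      forall x, D x -> `|f (u (n + N)%N) x| <= g x by apply: HN; exact: leq_addl.
  have ful x : D x -> f (u (n + N)%N) x @[n --> \oo] --> l x.
    move=> Dx; have : (fun n => f (u n) x) @ \oo --> l x.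
      by move/cvgr_dnbhsP : (fl x Dx); exact.
    by rewrite -(cvg_shiftn N).
  have ml : measurable_fun D l.
    by apply: (@measurable_fun_cvg _ _ _ _ (fun n => f (u (n + N)%N))) => // n; case: (fuP n).
  have mfu n : measurable_fun D (EFin \o f (u (n + N)%N)).
    by apply/measurable_EFinP; case: (fuP n).
  have ful' : {ae mu, forall x, D x -> (f (u (n + N)%N) x)%:E @[n --> \oo] --> (l x)%:E}.
    by apply: aeW => x Dx; apply/cvg_EFin; [exact: nearW|exact: ful].
  have fug' : {ae mu, forall x n, D x -> (`|(f (u (n + N)%N) x)%:E| <= (g x)%:E)%E}.
    by apply: aeW => x n Dx /=; rewrite lee_fin; case: (fuP n) => _; exact.
  have [li _ cvg_int] := dominated_convergence mD mfu
    ((measurable_EFinP D l).2 ml) ful' gi fug'.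
  split => //; rewrite -(cvg_shiftn N); apply: fine_cvg.
  by rewrite fineK//; exact: integrable_fin_num.
split; last by apply/cvgr_dnbhsP => u /main[].
(* Integrability of [l] takes just one sequence tending to [t] without meeting it. *)
have [|//] := main (fun n => t + n.+1%:R^-1).
split => [n|]; first by rewrite -subr_eq0 addrC addKr invr_eq0 pnatr_eq0.
rewrite -[X in _ --> X]addr0; apply: cvgD; first exact: cvg_cst.
exact: cvg_harmonic.
Qed.

End real_integrable.

(** * Weak convergence and densities *)

Section weak_topology.
Context {R : realType} {d : nat}.
Implicit Types (M : set 'rV[R]_d).

Lemma within_continuous_measurable M (f : 'rV[R]_d -> R) :
  measurable M -> {within M, continuous f} -> measurable_fun M f.
Proof.
move=> mM /continuousP cf; apply: (measurability _ (RGenOpens.measurableE R)).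
move=> _ [_ [a [b ->]] <-].
have oab : open [set` `]a, b[] by exact: interval_open.
have /open_subspaceP[V oV VM] := cf _ oab.
by rewrite setIC -VM; apply: measurableI => //; exact: sub_sigma_algebra.
Qed.

Lemma cvg_initial_topology (S : choiceType) (T : topologicalType) (f : S -> T)
    (F : set_system S) (s : S) : Filter F ->
  f x @[x --> F] --> f s -> F --> (s : initial_topology f).
Proof.
move=> FF Ff A /= [_ [[B oB <-] Bs] BA].
by apply: filterS BA _; apply: Ff; exact: open_nbhs_nbhs.
Qed.

Lemma cvg_ptws (I U : Type) (V : topologicalType) (F : set_system I)
    (g : I -> U -> V) (h : U -> V) : Filter F ->
  (forall u, g i u @[i --> F] --> h u) ->
  g i @[i --> F] --> (h : {ptws U -> V}).
Proof.
move=> FF gh; apply/cvg_sup => u.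
by apply: (@cvg_initial_topology _ _ (fun f : U -> V => f u)); exact: gh.
Qed.

Lemma cvg_prob_on (I : Type) (F : set_system I) M (m_ : I -> prob_on M)
    (m : prob_on M) : Filter F ->
  (forall f : 'rV[R]_d -> R, {within M, continuous f} -> bounded_on M f ->
    \int[m_ i]_(x in M) f x @[i --> F] --> \int[m]_(x in M) f x) ->
  m_ i @[i --> F] --> m.
Proof.
move=> FF mf; apply: cvg_initial_topology.
by apply: cvg_ptws => -[f [cf bf]]; exact: mf.
Qed.

Lemma cvg_joint (P : topologicalType) M (G : P -> 'rV[R]_d -> R)
    (I : Type) (F : set_system I) (p_ : I -> P) (x_ : I -> 'rV[R]_d) p x :
  Filter F ->
  {within [set z : P * 'rV[R]_d | M z.2], continuous (fun z => G z.1 z.2)} ->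
  M x -> (\forall i \near F, M (x_ i)) ->
  p_ i @[i --> F] --> p -> x_ i @[i --> F] --> x ->
  G (p_ i) (x_ i) @[i --> F] --> G p x.
Proof.
move=> FF /subspace_continuousP cG Mx Mx_ pp xx.
apply: (cvg_comp (fun i => (p_ i, x_ i)) (fun z => G z.1 z.2) _ (cG (p, x) Mx)).
have pxx : (p_ i, x_ i) @[i --> F] --> (p, x).
  exact: (@cvg_pair _ _ _ F (nbhs p) (nbhs x) FF _ _ p_ x_ pp xx).
by move=> A /pxx pA; apply: filterS2 Mx_ pA => i Mi; exact.
Qed.

Lemma joint_continuous_section (P : topologicalType) M (G : P -> 'rV[R]_d -> R) p :
  {within [set z : P * 'rV[R]_d | M z.2], continuous (fun z => G z.1 z.2)} ->
  {within M, continuous (G p)}.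
Proof.
move=> cG; apply/subspace_continuousP => x Mx.
apply: (@cvg_joint P M G _ _ (fun=> p) id) => //.
- exact: withinT.
- exact: cvg_cst.
- exact: cvg_within.
Qed.

End weak_topology.

Section prob_on_integral.
Context {R : realType} {d : nat} (M : set 'rV[R]_d).
Hypothesis mM : measurable M.
Implicit Types (m : prob_on M) (f p : 'rV[R]_d -> R).
Local Notation leb := (lebesgue_rV R d).

Lemma prob_on_nonempty m : M !=set0.
Proof.
apply/set0P/eqP => M0; have := prob_on1 m.
rewrite (_ : prob_on_val m M = prob_on_val m set0); last by congr (prob_on_val m _).
by rewrite measure0 => /eqP; rewrite eqe eq_sym oner_eq0.
Qed.

Lemma bounded_integ m f C : measurable_fun M f ->
  (forall x, M x -> `|f x| <= C) -> m.-integrable M (EFin \o f).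
Proof.
move=> mf fC; apply: (@le_integ _ _ _ m M mM _ (cst C)) => //.
exact: finite_measure_integrable_cst.
Qed.

(** Additivity in the measure is applied to nonnegative integrands, so [f] is shifted by its bound
    [C]; the shift cancels because all three measures give mass 1 to [M]. *)
Lemma Rintegral_mix e m m' f : measurable_fun M f -> bounded_on M f ->
  \int[mix e m m']_(x in M) f x =
  \int[m]_(x in M) f x + clamp01 e * int_diff m m' f.
Proof.
move=> mf [C fC].
have ge0_mix (h : 'rV[R]_d -> R) : measurable_fun M h ->
    (forall x, M x -> 0 <= h x <= C + C) ->
    \int[mix e m m']_(x in M) h x =
    (1 - clamp01 e) * \int[m]_(x in M) h x + clamp01 e * \int[m']_(x in M) h x.
  move=> mh hC.
  have h0 x : M x -> (0 <= (h x)%:E)%E by move=> /hC /andP[h0 _]; rewrite lee_fin.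
  have hint (n : prob_on M) : n.-integrable M (EFin \o h).
    by apply: (@bounded_integ _ _ (C + C)) => // x /hC /andP[? ?]; rewrite ger0_norm.
  have mh' : measurable_fun M (EFin \o h) by exact/measurable_EFinP.
  have hfin (n : prob_on M) : (\int[n]_(x in M) (h x)%:E)%E \is a fin_num.
    exact: integrable_fin_num (hint n).
  rewrite /Rintegral /= /mix_measure ge0_integral_measure_add//.
  by rewrite !ge0_integral_mscale//= fineD ?fineM// fin_numM.
have fint (n : prob_on M) : n.-integrable M (EFin \o f).
  exact: (@bounded_integ _ _ C).
have shift (n : prob_on M) :
    \int[n]_(x in M) (f x + C) = \int[n]_(x in M) f x + C.
  rewrite (RintegralD mM (fint n)); last exact: finite_measure_integrable_cst.
  rewrite Rintegral_cst//; rewrite -[X in _ = _ + X]mulr1.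
  by congr (_ + _ * _); exact: (congr1 fine (prob_on1 n)).
have mh : measurable_fun M (fun x => f x + C) by exact: measurable_funD.
have hC x : M x -> 0 <= f x + C <= C + C.
  by move=> /fC; rewrite ler_norml => /andP[? ?]; apply/andP; split; lra.
have := ge0_mix _ mh hC; rewrite (shift m) (shift m') (shift (mix e m m')) /int_diff.
lra.
Qed.

End prob_on_integral.

Section density.
Context {R : realType} {d : nat} (M : set 'rV[R]_d).
Hypothesis mM : measurable M.
Implicit Types (m : prob_on M) (f p : 'rV[R]_d -> R).
Local Notation leb := (lebesgue_rV R d).

Lemma is_density_integ m p : is_density m p -> leb.-integrable M (EFin \o p).
Proof.
case=> mp p0 mE; apply/integrableP; split; first exact/measurable_EFinP.
under eq_integral => x /set_mem Mx do rewrite /= ger0_norm ?p0//.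
rewrite -mE//; apply: (@le_lt_trans _ _ 1%E); last exact: ltry.
by have -> : m M = 1%E by exact: prob_on1.
Qed.

Lemma is_density_int1 m p : is_density m p -> \int[leb]_(x in M) p x = 1.
Proof.
case=> mp p0 mE; rewrite /Rintegral -mE//.
exact: (congr1 fine (prob_on1 m)).
Qed.

Lemma prob_on_setI m A : measurable A -> m A = m (A `&` M).
Proof.
move=> mA; have mCM0 : m (~` M) = 0%E.
  by rewrite probability_setC// [X in (1 - X)%E](prob_on1 m) subee.
have mAM : m (A `\` M) = 0%E.
  apply: (subset_measure0 _ _ _ mCM0); [exact: measurableD|exact: measurableC|].
  by move=> x [].
by rewrite (measureDI m mA mM) [X in (X + _)%E]mAM add0e.
Qed.

Lemma is_density_abs_cont m p : is_density m p -> abs_cont m.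
Proof.
case=> mp p0 mE; apply/null_content_dominatesP => A mA A0.
have mAM : measurable (A `&` M) by exact: measurableI.
have AMM : A `&` M `<=` M by exact: subIsetr.
rewrite prob_on_setI// (mE _ mAM AMM).
apply: null_set_integral; first exact: mAM.
  by apply/measurable_EFinP; apply: measurable_funS mp.
exact: (subset_measure0 mAM mA (@subIsetl _ A M) A0).
Qed.

(** Bridge between the Radon-Nikodym representative inside [KLm] and [KL_to_BR] and the pointwise
    densities that solve the flow equation. *)
Lemma density_ae_eq m p : is_density m p -> ae_eq leb M (density m) p.
Proof.
move=> dmp; have ac := is_density_abs_cont dmp; case: (dmp) => mp p0 mE.
have RNfin x : Radon_Nikodym (charge_of_finite_measure m) leb x \is a fin_num.
  exact: Radon_Nikodym_fin_num.
have : ae_eq leb M (EFin \o density m) (EFin \o p).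
  have -> : EFin \o density m = Radon_Nikodym (charge_of_finite_measure m) leb.
    by apply/funext => x; rewrite /= /density fineK.
  apply: integral_ae_eq => //.
  - by apply: (integrableS measurableT) => //; exact: Radon_Nikodym_integrable.
  - exact/measurable_EFinP.
  - move=> E EM mE'; rewrite -Radon_Nikodym_integral//.
    exact: mE.
by apply: filterS => x + Mx => /(_ Mx) /= [].
Qed.

Lemma measurable_density m : abs_cont m -> measurable_fun M (density m).
Proof.
move=> ac; apply: measurableT_comp => //; apply: measurable_funTS.
by apply: measurable_int; exact: Radon_Nikodym_integrable.
Qed.

Lemma abs_cont_density m : abs_cont m -> exists p, is_density m p.
Proof.
(* This representative is nonnegative and finite at every point, which [is_density] asks for on
   [M]. *)
move=> ac; exists (fun x => fine (Radon_Nikodym_SigmaFinite.f m leb x)).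
have f0 := Radon_Nikodym_SigmaFinite.f_ge0 ac.
have ffin := Radon_Nikodym_SigmaFinite.f_fin_num ac.
have fi := Radon_Nikodym_SigmaFinite.f_integrable ac.
split => [|x Mx|A mA AM].
- apply: measurableT_comp => //; apply: measurable_funTS; exact: measurable_int fi.
- exact: fine_ge0.
- under eq_integral do rewrite fineK//.
  exact: Radon_Nikodym_SigmaFinite.f_integral.
Qed.

Lemma is_density_Rintegral m p f C : is_density m p -> measurable_fun M f ->
  (forall x, M x -> `|f x| <= C) ->
  \int[m]_(x in M) f x = \int[leb]_(x in M) (f x * p x).
Proof.
move=> dmp mf fC; have ac := is_density_abs_cont dmp.
have fi : m.-integrable M (EFin \o f) by exact: bounded_integ fC.
rewrite /Rintegral -(Radon_Nikodym_change_of_variables ac)//; congr fine.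
apply: ae_eq_integral => //.
- apply: emeasurable_funM; first exact/measurable_EFinP.
  by apply: measurable_funTS; apply: measurable_int; exact: Radon_Nikodym_integrable.
- by apply/measurable_EFinP; apply: measurable_funM => //; case: dmp.
apply: filterS (density_ae_eq dmp) => x + Mx => /(_ Mx) <- /=.
by rewrite EFinM /density fineK//; exact: Radon_Nikodym_fin_num.
Qed.

Lemma int_diffE m m' p p' f C : is_density m p -> is_density m' p' ->
  measurable_fun M f -> (forall x, M x -> `|f x| <= C) ->
  int_diff m m' f = \int[leb]_(x in M) (f x * (p' x - p x)).
Proof.
move=> dp dp' mf fC; rewrite /int_diff.
rewrite (is_density_Rintegral dp' mf fC) (is_density_Rintegral dp mf fC).
rewrite -RintegralB//; last 2 first.
- exact: (integM_bounded mM mf fC (is_density_integ dp')).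
- exact: (integM_bounded mM mf fC (is_density_integ dp)).
by apply: eq_Rintegral => x _; rewrite mulrBr.
Qed.

Lemma int_diff_le m m' p p' f C : is_density m p -> is_density m' p' ->
  measurable_fun M f -> (forall x, M x -> `|f x| <= C) ->
  `|int_diff m m' f| <= C * \int[leb]_(x in M) `|p' x - p x|.
Proof.
move=> dp dp' mf fC; rewrite (int_diffE dp dp' mf fC).
have pi := integB mM (is_density_integ dp') (is_density_integ dp).
have fpi := integM_bounded mM mf fC pi.
rewrite (le_trans (le_normr_Rintegral mM fpi))// -RintegralZl//; last exact: integ_norm.
apply: le_Rintegral => //; [exact: integ_norm|exact/integZ/integ_norm|].
by move=> x Mx; rewrite normrM ler_wpM2r// fC.
Qed.

End density.

(** * Mean value theorem for flat derivatives *)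

Lemma dnbhs_cvg_continuous (R : realType) (V : topologicalType) (f : R -> V) (t : R) :
  f x @[x --> t^'] --> f t -> f x @[x --> t] --> f t.
Proof.
move=> ft A fA; have ftA : nbhs t (fun x => x != t -> A (f x)) by exact: ft.
change (nbhs t (fun x => A (f x))); apply: filterS ftA => x.
by have [->|xt] := eqVneq x t; [move=> _; exact: nbhs_singleton fA|exact].
Qed.

Section flat_derivative_mean_value.
Context {R : realType} {d : nat} (M : set 'rV[R]_d).
Hypothesis mM : measurable M.
Variables (G : prob_on M -> R) (dG : prob_on M -> 'rV[R]_d -> R) (C : R).
Hypothesis hG : flat_derivative G dG.
Hypothesis dGC : forall m x, M x -> `|dG m x| <= C.
Implicit Types m : prob_on M.

Lemma flat_derivative_measurable m : measurable_fun M (dG m).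
Proof.
apply: within_continuous_measurable => //.
by case: hG => + _ _ _; exact: joint_continuous_section.
Qed.

Lemma continuous_clamp01 : continuous (@clamp01 R).
Proof.
move=> x; apply: (@continuous_max R R^o (cst 0) (fun e => Num.min e 1)).
  exact: cvg_cst.
by apply: (@continuous_min R R^o id (cst 1)); [exact: cvg_id|exact: cvg_cst].
Qed.

Lemma continuous_mix m m' : continuous (fun e : R => mix e m m').
Proof.
move=> e0; apply: cvg_prob_on => f cf bf.
have mf := within_continuous_measurable mM cf.
under eq_fun do rewrite Rintegral_mix//.
rewrite Rintegral_mix//; apply: cvgD; first exact: cvg_cst.
by apply: cvgM; [exact: continuous_clamp01|exact: cvg_cst].
Qed.

Lemma continuous_int_diff_mix m m' :
  continuous (fun e : R => int_diff m m' (dG (mix e m m'))).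
Proof.
have ci (n : prob_on M) (e0 : R) :
    \int[n]_(x in M) dG (mix e m m') x @[e --> e0^'] -->
    \int[n]_(x in M) dG (mix e0 m m') x.
  have [] // := @dominated_cvg_dnbhs _ _ _ n M mM e0
    (fun e => dG (mix e m m')) (dG (mix e0 m m')) (cst C).
  - by apply: nearW => e; split => [|x Mx]; [exact: flat_derivative_measurable|exact: dGC].
  - exact: finite_measure_integrable_cst.
  - move=> x Mx; case: hG => cG _ _ _.
    apply: (cvg_joint _ cG Mx); [exact: nearW| |exact: cvg_cst].
    by apply: cvg_trans (@continuous_mix m m' e0); apply: cvg_app; exact: nbhs_dnbhs.
by move=> e0; apply: dnbhs_cvg_continuous; apply: cvgB; exact: ci.
Qed.

(** The integrand over the unit interval is continuous in [e], so its average lies between its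
    extrema and is one of its values. Limits can then be taken at a single intermediate measure. The
    location of [e] is not recorded, since [mix] clamps it. *)
Lemma flat_mean_value m m' :
  exists e, G m' - G m = int_diff m m' (dG (mix e m m')).
Proof.
set h := fun e => int_diff m m' (dG (mix e m m')).
have ch : {within `[0%R, 1%R], continuous h}.
  by apply: continuous_subspaceT; exact: continuous_int_diff_mix.
have [a a01 ha] := EVT_min ler01 ch; have [b b01 hb] := EVT_max ler01 ch.
have hi : (@lebesgue_measure R).-integrable `[0%R, 1%R] (EFin \o h).
  by apply: continuous_compact_integrable => //; exact: segment_compact.
have ci (c : R) : (@lebesgue_measure R).-integrable `[0%R, 1%R] (EFin \o cst c).
  by apply: continuous_compact_integrable => //; [exact: segment_compact|
    apply: continuous_subspaceT => ?; exact: cvg_cst].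
have intc (c : R) : (\int[lebesgue_measure]_(e in `[0%R, 1%R]) c%:E = c%:E)%E.
  rewrite integral_cst// [X in (_ * X)%E](@lebesgue_measure_itv R `[0%R, 1%R])/=.
  by rewrite lte_fin ltr01 oppr0 adde0 mule1.
have hE : (G m' - G m)%:E = (\int[lebesgue_measure]_(e in `[0%R, 1%R]) (h e)%:E)%E.
  by case: hG.
have hmin : h a <= G m' - G m.
  rewrite -lee_fin hE -(intc (h a)); apply: le_integral => //; first exact: ci.
  by move=> e; rewrite inE => e01; rewrite lee_fin ha.
have hmax : G m' - G m <= h b.
  rewrite -lee_fin hE -(intc (h b)); apply: le_integral => //; first exact: ci.
  by move=> e; rewrite inE => e01; rewrite lee_fin hb.
have chs (x y : R) : {within `[x, y], continuous h}.
  by apply: continuous_subspaceT; exact: continuous_int_diff_mix.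
have hab x y : x <= y -> Num.min (h x) (h y) <= G m' - G m <= Num.max (h x) (h y) ->
    exists e, G m' - G m = h e.
  by move=> xy /(IVT xy (chs x y))[e _ he]; exists e.
have [ab|/ltW ba] := leP a b.
- by apply: (hab _ _ ab); rewrite ge_min hmin /= le_max hmax orbT.
- by apply: (hab _ _ ba); rewrite ge_min hmin orbT /= le_max hmax.
Qed.

Lemma flat_lipschitz m m' p p' : is_density m p -> is_density m' p' ->
  `|G m' - G m| <= C * \int[lebesgue_rV R d]_(x in M) `|p' x - p x|.
Proof.
move=> dp dp'; have [e ->] := flat_mean_value m m'.
apply: (int_diff_le mM dp dp'); first exact: flat_derivative_measurable.
exact: dGC.
Qed.

End flat_derivative_mean_value.

(** * Linear relaxation and entropy inequalities *)

Section one_sided_ode.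
Context {R : realType}.
Implicit Types (f q : R -> R) (alpha c s t l : R).

Lemma cvg_quotient_is_derive f t l :
  (f s - f t) / (s - t) @[s --> t^'] --> l -> is_derive t 1 f l.
Proof.
move=> /cvgr_dnbhsP fl.
have : h^-1 *: ((f \o shift t) (h *: (1 : R)) - f t) @[h --> 0^'] --> l.
  apply/cvgr_dnbhsP => u [u0 u_cvg].
  have : (fun n => (f (u n + t) - f t) / (u n + t - t)) @ \oo --> l.
    apply: fl; split => [n|]; first by rewrite -subr_eq0 addrK.
    by rewrite -[X in _ --> X]add0r; apply: cvgD => //; exact: cvg_cst.
  apply: cvg_trans; apply: near_eq_cvg; apply: nearW => n.
  by rewrite /= addrK mulrC /shift/= [_ *: 1]mulr1.
move=> fl'; split; first by apply/cvg_ex; exists l.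
by rewrite /derive; exact: cvg_lim.
Qed.

Lemma is_derive_quotient f t l : is_derive t 1 f l ->
  (f s - f t) / (s - t) @[s --> t^'] --> l.
Proof.
move=> [fd <-]; have {fd} : h^-1 *: ((f \o shift t) (h *: (1 : R)) - f t) @[h --> 0^']
    --> 'D_1 f t by exact: fd.
move/cvgr_dnbhsP => fl; apply/cvgr_dnbhsP => u [ut u_cvg].
have : (fun n => (u n - t)^-1 *: ((f \o shift t) ((u n - t) *: (1 : R)) - f t)) @ \oo
    --> 'D_1 f t.
  apply: fl; split => [n|]; first by rewrite subr_eq0.
  by rewrite -(subrr t); apply: cvgB => //; exact: cvg_cst.
apply: cvg_trans; apply: near_eq_cvg; apply: nearW => n.
by rewrite /= /shift/= [_ *: 1]mulr1 subrK mulrC.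
Qed.

Lemma near_gt0 t : 0 < t -> \forall s \near t, 0 < s.
Proof. by move=> t0; exact: (@cvgr_gt _ _ (nbhs t) _ id t cvg_id 0 t0). Qed.

Lemma derivative_ge0_quotient f t l : 0 < t -> derivative_ge0 f t l ->
  (f s - f t) / (s - t) @[s --> t^'] --> l.
Proof.
move=> t0 fl A /fl; rewrite /within /= => lA.
have near_ge0 : t^' (fun s => 0 <= s).
  by apply: nbhs_dnbhs; apply: filterS (near_gt0 t0) => s /ltW.
by apply: filterS2 near_ge0 lA => s s0; exact.
Qed.

Lemma derivative_ge0_cvg f t l : derivative_ge0 f t l ->
  f s @[s --> within [set s | 0 <= s] (nbhs t)] --> f t.
Proof.
move=> fl.
have fd : f s @[s --> within [set s | 0 <= s] t^'] --> f t.
  have -> : f t = f t + (t - t) * l by rewrite subrr mul0r addr0.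
  apply: (@cvg_trans _ ((fun s => f t + (s - t) * ((f s - f t) / (s - t))) @
      within [set s | 0 <= s] t^')).
    apply: near_eq_cvg.
    have : \forall s \near t^', s != t by exact: nbhs_dnbhs_neq.
    rewrite /within; apply: filterS => s st _.
    by rewrite mulrCA mulfV ?subr_eq0// mulr1 addrC subrK.
  apply: cvgD; first exact: cvg_cst.
  apply: cvgM fl; apply: cvgB; last exact: cvg_cst.
  apply: cvg_trans (@nbhs_dnbhs _ t) => A; exact: cvg_within.
move=> A fA; have : t^' (fun s => 0 <= s -> A (f s)) by exact: fd.
rewrite /dnbhs /within /= => ftA.
change (nbhs t (fun s => 0 <= s -> A (f s))); apply: filterS ftA => s.
by have [->|st] := eqVneq s t; [move=> _ _; exact: nbhs_singleton fA|exact].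
Qed.

Lemma derivative_ge0N f t l :
  derivative_ge0 f t l -> derivative_ge0 (fun s => - f s) t (- l).
Proof.
move=> fl; rewrite /derivative_ge0.
under eq_fun do rewrite -opprD mulNr.
by apply: cvgN.
Qed.

Lemma is_derive_expR_scale alpha t :
  is_derive t 1 (fun s : R => expR (alpha * s)) (alpha * expR (alpha * t)).
Proof.
have dl : is_derive t 1 (cst alpha * id : R -> R) (alpha *: 1 + t *: 0).
  exact: is_deriveM.
have dE := is_derive1_comp (is_derive_expR ((cst alpha * id : R -> R) t)) dl.
by apply: (is_derive_eq dE); rewrite /= /GRing.scale/= !mulr1 mulr0 addr0 mulrC.
Qed.

(** Integrating factor: the derivative is [alpha * expR (alpha * r) * (q r - c)], whose sign comes
    from the bound on [q] alone. *)
Lemma ode_ndecr alpha c f q : 0 < alpha ->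
  (forall t, 0 <= t -> derivative_ge0 f t (alpha * (q t - f t))) ->
  (forall t, 0 <= t -> c <= q t) ->
  forall s t, 0 <= s -> s <= t ->
    expR (alpha * s) * (f s - c) <= expR (alpha * t) * (f t - c).
Proof.
move=> a0 fq cq; pose h r := expR (alpha * r) * (f r - c).
have dh (r : R) : 0 < r -> is_derive r 1 h (alpha * expR (alpha * r) * (q r - c)).
  move=> r0; have fr := cvg_quotient_is_derive (derivative_ge0_quotient r0 (fq r (ltW r0))).
  have dE := is_derive_expR_scale alpha r.
  have dB : is_derive r 1 (fun s : R => f s - c) (alpha * (q r - f r) - 0).
    exact: is_deriveB.
  apply: (is_derive_eq (is_deriveM dE dB)).
  by rewrite /= /GRing.scale/=; ring.
apply: (@ger0_derive1_ndecry _ h 0).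
- by move=> r; rewrite in_itv/= andbT => /dh dhr; exact: ex_derive.
- move=> r; rewrite in_itv/= andbT => r0; have dhr := dh _ r0.
  rewrite derive1E derive_val mulr_ge0 ?subr_ge0 ?cq ?(ltW r0)//.
  by rewrite mulr_ge0 ?expR_ge0// ltW.
(* Monotonicity down to time 0, where the derivative of [f] is one-sided, rests on continuity
   relative to the half-line. *)
- apply/subspace_continuousP => r; rewrite /= in_itv/= andbT => r0.
  have -> : [set` `[0, +oo[] = [set s : R | 0 <= s].
    by apply/seteqP; split => s /=; rewrite in_itv/= andbT.
  apply: cvgM.
    apply: (@cvg_within_filter _ _ (fun s => expR (alpha * s))).
    apply: continuous_comp; last exact: continuous_expR.
    by apply: cvgM; [exact: cvg_cst|exact: cvg_id].
  apply: cvgB; last exact: cvg_cst.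
  exact: derivative_ge0_cvg (fq r r0).
Qed.

Lemma ode_nincr alpha c f q : 0 < alpha ->
  (forall t, 0 <= t -> derivative_ge0 f t (alpha * (q t - f t))) ->
  (forall t, 0 <= t -> q t <= c) ->
  forall s t, 0 <= s -> s <= t ->
    expR (alpha * t) * (f t - c) <= expR (alpha * s) * (f s - c).
Proof.
move=> a0 fq qc s t s0 st.
have := @ode_ndecr alpha (- c) (fun r => - f r) (fun r => - q r) a0 _ _ s t s0 st.
rewrite /= -!opprD !mulrN lerN2; apply.
- by move=> r r0; rewrite -opprD mulrN; exact: derivative_ge0N (fq r r0).
- by move=> r r0; rewrite lerN2 qc.
Qed.

Lemma expR_sub_ge (x y : R) : 0 <= x -> 0 <= y -> y - x * y <= expR (- x) * y.
Proof.
by move=> x0 y0; rewrite -[leLHS]/(y - x * y) -{1}[y]mul1r -mulrBl ler_wpM2r// expR_ge1Dx.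
Qed.

(** The monotone quantities for the constants 0 and [c] bound the decrease of [f] by [alpha] |s - t|
    times its value at the earlier time, and its increase by [alpha] |s - t| times [c]. The earlier
    value is at most [expR (alpha * t) * f t], so the bound refers to time [t] only and can dominate
    difference quotients at [t]. *)
Lemma ode_dist alpha c f q : 0 < alpha -> 0 <= c ->
  (forall t, 0 <= t -> derivative_ge0 f t (alpha * (q t - f t))) ->
  (forall t, 0 <= t -> 0 <= q t <= c) -> (forall t, 0 <= t -> 0 <= f t) ->
  forall s t, 0 <= s -> 0 <= t ->
    `|f s - f t| <= alpha * `|s - t| * (expR (alpha * t) * f t + c).
Proof.
move=> a0 c0 fq qc f0.
have q0 t : 0 <= t -> 0 <= q t by move=> /qc/andP[].
have qlec t : 0 <= t -> q t <= c by move=> /qc/andP[].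
have key s t : 0 <= s -> s <= t ->
    [/\ f s - f t <= alpha * (t - s) * f s, f t - f s <= alpha * (t - s) * c &
        f s <= expR (alpha * t) * f t].
  move=> s0 st; have t0 := le_trans s0 st; have d0 : 0 <= alpha * (t - s).
    by rewrite mulr_ge0 ?subr_ge0// ltW.
  have E : expR (alpha * s) = expR (alpha * t) * expR (- (alpha * (t - s))).
    by rewrite -expRD; congr expR; ring.
  have := ode_ndecr a0 fq q0 s0 st; rewrite !subr0 E -mulrA ler_pM2l ?expR_gt0// => ft.
  have := ode_nincr a0 fq qlec s0 st; rewrite E -mulrA ler_pM2l ?expR_gt0// => fs.
  have e1 := expR_sub_ge d0 (f0 s s0); have e2 := expR_sub_ge d0 c0.
  have e3 : expR (- (alpha * (t - s))) * f s <= f s.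
    by rewrite ler_piMl ?f0// -expR0 ler_expR oppr_le0.
  split; [lra|lra|].
  have := ode_ndecr a0 fq q0 s0 st; rewrite !subr0; apply: le_trans.
  by rewrite ler_peMl ?f0// -expR0 ler_expR mulr_ge0// ltW.
move=> s t s0 t0; have et : f t <= expR (alpha * t) * f t.
  by rewrite ler_peMl ?f0// -expR0 ler_expR mulr_ge0// ltW.
have [st|/ltW ts] := leP s t.
- have [k1 k2 k3] := key s t s0 st.
  have d0 : 0 <= alpha * (t - s) by rewrite mulr_ge0 ?subr_ge0// ltW.
  rewrite (ler0_norm (_ : s - t <= 0)) ?subr_le0// opprB ler_norml mulrDr.
  have := ler_wpM2l d0 k3; have := mulr_ge0 d0 c0; have := mulr_ge0 d0 (f0 s s0).
  by move=> *; apply/andP; split; lra.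
- have [k1 k2 k3] := key t s t0 ts.
  have d0 : 0 <= alpha * (s - t) by rewrite mulr_ge0 ?subr_ge0// ltW.
  rewrite (ger0_norm (_ : 0 <= s - t)) ?subr_ge0// ler_norml mulrDr.
  have := ler_wpM2l d0 et; have := mulr_ge0 d0 c0; have := mulr_ge0 d0 (f0 t t0).
  by move=> *; apply/andP; split; lra.
Qed.

Lemma ode_lower alpha c f q : 0 < alpha ->
  (forall t, 0 <= t -> derivative_ge0 f t (alpha * (q t - f t))) ->
  (forall t, 0 <= t -> c <= q t) ->
  forall t, 0 <= t -> expR (- (alpha * t)) * f 0 + (1 - expR (- (alpha * t))) * c <= f t.
Proof.
move=> a0 fq qc t t0; have := ode_ndecr a0 fq qc (lexx 0) t0.
rewrite mulr0 expR0 mul1r -(ler_pM2l (expR_gt0 (- (alpha * t)))) mulrA -expRD.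
by rewrite addNr expR0; lra.
Qed.

Lemma ode_upper alpha c f q : 0 < alpha ->
  (forall t, 0 <= t -> derivative_ge0 f t (alpha * (q t - f t))) ->
  (forall t, 0 <= t -> q t <= c) ->
  forall t, 0 <= t -> f t <= expR (- (alpha * t)) * f 0 + (1 - expR (- (alpha * t))) * c.
Proof.
move=> a0 fq qc t t0; have := ode_nincr a0 fq qc (lexx 0) t0.
rewrite mulr0 expR0 mul1r -(ler_pM2l (expR_gt0 (- (alpha * t)))) mulrA -expRD.
by rewrite addNr expR0; lra.
Qed.

End one_sided_ode.

Section entropy_inequalities.
Context {R : realType}.
Implicit Types a b p q l : R.

Lemma ln_le_subr1 (x : R) : 0 < x -> ln x <= x - 1.
Proof.
move=> x0; have := @le_ln1Dx R (x - 1); have -> : 1 + (x - 1) = x by ring.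
by apply; lra.
Qed.

(** The inequality [ln y <= y - 1] at [y = q / p]. It supplies the integrable minorant [p - q] of
    the entropy density and, after integration, the nonnegativity of relative entropy. *)
Lemma entropy_ge p q : 0 <= p -> 0 < q -> p - q <= p * ln (p / q).
Proof.
rewrite le_eqVlt => /predU1P[<- q0|p0 q0]; first by rewrite mul0r sub0r oppr_le0 ltW.
have := ln_le_subr1 (divr_gt0 q0 p0).
rewrite -invf_div lnV ?posrE ?divr_gt0// -(ler_pM2l p0) mulrN mulrBr mulr1.
by rewrite invf_div mulrCA mulfV ?gt_eqF// mulr1; lra.
Qed.

Lemma entropy_split p q c : 0 <= p -> 0 < q -> 0 < c ->
  p * ln (p / q) = p * ln (p / c) + p * ln (c / q).
Proof.
rewrite le_eqVlt => /predU1P[<- q0 c0|p0 q0 c0]; first by rewrite !mul0r addr0.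
rewrite -mulrDr -lnM ?posrE ?divr_gt0//; congr (_ * ln _).
by rewrite mulrA divfK// gt_eqF.
Qed.

(** Both entropies are split through the mixture [c]. The lower bounds [a - c] and [b - c] given by
    [entropy_ge] have weighted sum zero, and what remains is linear. If [c = 0], both weighted terms
    vanish. *)
Lemma entropy_convex a b q l : 0 <= a -> 0 < b -> 0 < q -> 0 <= l <= 1 ->
  ((1 - l) * a + l * b) * ln (((1 - l) * a + l * b) / q) <=
  (1 - l) * (a * ln (a / q)) + l * (b * ln (b / q)).
Proof.
move=> a0 b0 q0 /andP[l0 l1]; set c := (1 - l) * a + l * b.
have l1' : 0 <= 1 - l by lra.
have : 0 <= c by rewrite addr_ge0 ?mulr_ge0// ltW.
rewrite le_eqVlt => /predU1P[c0|c0].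
  have lb0 : 0 <= l * b by rewrite mulr_ge0// ltW.
  have la0 : 0 <= (1 - l) * a by rewrite mulr_ge0.
  have lb : l * b = 0 by move: c0; rewrite /c; lra.
  have la : (1 - l) * a = 0 by move: c0; rewrite /c; lra.
  by rewrite -c0 !mulrA la lb !mul0r addr0.
rewrite (entropy_split a0 q0 c0) (entropy_split (ltW b0) q0 c0).
have := ler_wpM2l l1' (entropy_ge a0 c0).
have := ler_wpM2l l0 (entropy_ge (ltW b0) c0).
have -> : c * ln (c / q) = (1 - l) * (a * ln (c / q)) + l * (b * ln (c / q)).
  by rewrite /c; ring.
have : (1 - l) * (a - c) + l * (b - c) = 0 by rewrite /c; ring.
by rewrite !mulrDr; lra.
Qed.

(** The bound is relative to [p], so that integrability of [p] and of [p * ln (p / q)] suffices to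
    dominate increments. The term [p' * ln (p' / p)] is small because it lies between [p' - p] and
    [p' / p * (p' - p)]. *)
Lemma entropy_lipschitz p p' q q' delta e : 0 < p -> 0 < p' -> 0 < q -> 0 < q' ->
  `|p' - p| <= delta * p -> `|ln q' - ln q| <= e ->
  `|p' * ln (p' / q') - p * ln (p / q)| <=
    p * (delta * `|ln (p / q)| + (1 + delta) * (delta + e)).
Proof.
move=> p0 p'0 q0 q'0 pd qe.
have d0 : 0 <= delta by have := le_trans (normr_ge0 _) pd; rewrite pmulr_lge0.
have e0 := le_trans (normr_ge0 _) qe.
have p'p : p' <= (1 + delta) * p by have := le_trans (ler_norm _) pd; lra.
have -> : p' * ln (p' / q') - p * ln (p / q) =
    (p' - p) * ln (p / q) + (p' * ln (p' / p) - p' * (ln q' - ln q)).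
  by rewrite !ln_div ?posrE//; ring.
have H1 : `|(p' - p) * ln (p / q)| <= p * (delta * `|ln (p / q)|).
  by rewrite normrM mulrA (mulrC p delta) ler_wpM2r.
have H2 : `|p' * ln (p' / p)| <= (1 + delta) * (delta * p).
  have lo := entropy_ge (ltW p'0) p0.
  have up : p' * ln (p' / p) <= p' / p * (p' - p).
    apply: (le_trans (ler_wpM2l (ltW p'0) (ln_le_subr1 (divr_gt0 p'0 p0)))).
    by rewrite le_eqVlt; apply/orP; left; apply/eqP; field; rewrite gt_eqF.
  have up2 : p' / p * (p' - p) <= (1 + delta) * (delta * p).
    apply: (@le_trans _ _ (p' / p * (delta * p))).
      apply: ler_wpM2l; first by rewrite divr_ge0// ltW.
      exact: le_trans (ler_norm _) pd.
    apply: ler_wpM2r; first by rewrite mulr_ge0// ltW.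
    by rewrite ler_pdivrMr.
  have lo2 : - ((1 + delta) * (delta * p)) <= p' - p.
    have := pd; rewrite ler_norml => /andP[+ _].
    have : 0 <= delta * (delta * p) by rewrite !mulr_ge0// ltW.
    lra.
  by rewrite ler_norml; apply/andP; split; lra.
have H3 : `|p' * (ln q' - ln q)| <= (1 + delta) * p * e.
  by rewrite normrM (gtr0_norm p'0) ler_pM// ltW.
rewrite (le_trans (ler_normD _ _))// (le_trans (lerD H1 (ler_normB _ _)))//.
lra.
Qed.

End entropy_inequalities.

(** * Relative entropy and best responses *)

Section relative_entropy.
Context {R : realType} {d : nat} (M : set 'rV[R]_d).
Hypothesis mM : measurable M.
Implicit Types p q : 'rV[R]_d -> R.
Local Notation leb := (lebesgue_rV R d).
Local Notation integ f := (leb.-integrable M (EFin \o f)).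

(* [r^-1 = r * expR (- ln (r ^+ 2))] also at [r = 0], where both sides vanish. *)
Lemma measurable_ln_ratio p q : measurable_fun M p -> measurable_fun M q ->
  measurable_fun M (fun x => ln (p x / q x)).
Proof.
move=> mp mq; apply: (@measurableT_comp _ _ _ _ _ _ (@ln R)) => //.
apply: measurable_funM => //.
apply: (eq_measurable_fun (fun x => q x * expR (- ln (q x ^+ 2)))).
  move=> x _; have [->|qx] := eqVneq (q x) 0; first by rewrite mul0r invr0.
  by rewrite expRN lnK ?posrE ?exprn_even_gt0//= expr2 invfM mulrA mulfV// mul1r.
apply: measurable_funM => //; do 3 apply: measurableT_comp => //.
exact: measurable_funX.
Qed.

Lemma measurable_entropy p q : measurable_fun M p -> measurable_fun M q ->
  measurable_fun M (fun x => p x * ln (p x / q x)).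
Proof. by move=> mp mq; apply: measurable_funM => //; exact: measurable_ln_ratio. Qed.

Lemma KL_integral p q : (forall x, M x -> 0 < q x) ->
  KL M p q = (\int[leb]_(x in M) (p x * ln (p x / q x))%:E)%E.
Proof.
move=> q0; rewrite /KL asboolT//; apply: aeW => x Mx qx.
by have := q0 x Mx; rewrite qx ltxx.
Qed.

Lemma KL_integ p q : integ p -> integ q -> (forall x, M x -> 0 <= p x) ->
  (forall x, M x -> 0 < q x) -> (KL M p q < +oo)%E ->
  integ (fun x => p x * ln (p x / q x)).
Proof.
move=> pi qi p0 q0; rewrite KL_integral//.
apply: (integral_fin_integ mM _ (integB mM pi qi)).
- exact: measurable_entropy (integ_measurable pi) (integ_measurable qi).
- by move=> x Mx; apply: entropy_ge; [exact: p0|exact: q0].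
Qed.

Lemma KL_Rintegral p q : (forall x, M x -> 0 < q x) ->
  integ (fun x => p x * ln (p x / q x)) ->
  KL M p q = (\int[leb]_(x in M) (p x * ln (p x / q x)))%:E.
Proof.
by move=> q0 fi; rewrite KL_integral// /Rintegral fineK//; exact: integrable_fin_num fi.
Qed.

Lemma KL_ge0 p q : integ p -> integ q -> (forall x, M x -> 0 <= p x) ->
  (forall x, M x -> 0 < q x) ->
  \int[leb]_(x in M) p x = \int[leb]_(x in M) q x -> (0 <= KL M p q)%E.
Proof.
move=> pi qi p0 q0 pq; have [KLoo|] := ltP (KL M p q) +oo%E; last by apply: le_trans; rewrite leey.
have fi := KL_integ pi qi p0 q0 KLoo; rewrite KL_Rintegral// lee_fin.
rewrite (_ : 0 = \int[leb]_(x in M) (p x - q x)); last by rewrite RintegralB// pq subrr.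
apply: le_Rintegral => //; first exact: integB.
by move=> x Mx; apply: entropy_ge; [exact: p0|exact: q0].
Qed.

Lemma eq_KL_ae p p' q q' : measurable_fun M p -> measurable_fun M p' ->
  measurable_fun M q -> measurable_fun M q' ->
  ae_eq leb M p p' -> ae_eq leb M q q' -> KL M p q = KL M p' q'.
Proof.
move=> mp mp' mq mq' pp' qq'; rewrite /KL.
have -> : `[< {ae leb, forall x, M x -> q x = 0 -> p x = 0} >] =
          `[< {ae leb, forall x, M x -> q' x = 0 -> p' x = 0} >].
  apply: asbool_equiv_eq; split; apply: filterS3 pp' qq' => x pp qq + Mx;
    by move=> /(_ Mx); rewrite (pp Mx) (qq Mx).
case: asboolP => // q0p0; apply: ae_eq_integral => //.
- by apply/measurable_EFinP; exact: measurable_entropy.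
- by apply/measurable_EFinP; exact: measurable_entropy.
by apply: filterS2 pp' qq' => x + + Mx => /(_ Mx) -> /(_ Mx) ->.
Qed.

End relative_entropy.

Section best_response.
Context {R : realType} {d : nat} (M : set 'rV[R]_d) (U : 'rV[R]_d -> R) (C : R).
Hypothesis mM : measurable M.
Hypothesis hU : is_potential M U.
Local Notation leb := (lebesgue_rV R d).
Local Notation integ f := (leb.-integrable M (EFin \o f)).
Implicit Types g : 'rV[R]_d -> R.

Definition gibbs g (x : 'rV[R]_d) : R := expR (g x - U x).
Definition partition_fun g : R := \int[leb]_(x in M) gibbs g x.
(** [Psi] and [Phi] are instances by conversion, for [g] equal to [- (2 / sigma ^+ 2)] times [dF_nu]
    and to [2 / sigma ^+ 2] times [dF_mu]. With these signs both players are maximizers, and one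
    analysis covers both. *)
Definition best_response g : 'rV[R]_d -> R := normalized M (gibbs g).

Definition admissible g := measurable_fun M g /\ forall x, M x -> `|g x| <= C.

Lemma potential_integ : integ (fun x => expR (- U x)).
Proof.
case: hU => mU U1; apply/integrableP; split.
  by apply/measurable_EFinP; do 2 apply: measurableT_comp => //.
under eq_integral do rewrite /= ger0_norm ?expR_ge0//.
by rewrite U1 ltry.
Qed.

Lemma potential_int1 : \int[leb]_(x in M) expR (- U x) = 1.
Proof. by case: hU => mU U1; rewrite /Rintegral U1. Qed.

Lemma gibbs_gt0 g x : 0 < gibbs g x. Proof. exact: expR_gt0. Qed.

Lemma gibbsE g x : gibbs g x = expR (g x) * expR (- U x).
Proof. by rewrite /gibbs expRD. Qed.

Lemma gibbs_bounds g x : admissible g -> M x ->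
  expR (- C) * expR (- U x) <= gibbs g x <= expR C * expR (- U x).
Proof.
case=> _ gC Mx; have := gC x Mx; rewrite ler_norml => /andP[g1 g2].
by rewrite gibbsE !ler_pM2r ?expR_gt0// !ler_expR g1.
Qed.

Lemma gibbs_integ g : admissible g -> integ (gibbs g).
Proof.
move=> ag; apply: (@le_integ _ _ _ leb M mM _ (fun x => expR C * expR (- U x))).
- case: ag hU => mg _ [mU _]; apply: measurableT_comp => //.
  exact: measurable_funB.
- by move=> x Mx; rewrite ger0_norm ?expR_ge0//; have /andP[] := gibbs_bounds ag Mx.
- exact/integZ/potential_integ.
Qed.

Lemma partition_bounds g : admissible g -> expR (- C) <= partition_fun g <= expR C.
Proof.
move=> ag; have gi := gibbs_integ ag; have pi := potential_integ.
have -> : expR (- C) = \int[leb]_(x in M) (expR (- C) * expR (- U x)).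
  by rewrite RintegralZl// potential_int1 mulr1.
have -> : expR C = \int[leb]_(x in M) (expR C * expR (- U x)).
  by rewrite RintegralZl// potential_int1 mulr1.
by apply/andP; split; apply: le_Rintegral => //; try exact: integZ;
  move=> x Mx; have /andP[] := gibbs_bounds ag Mx.
Qed.

Lemma partition_gt0 g : admissible g -> 0 < partition_fun g.
Proof. by move=> /partition_bounds/andP[+ _]; exact/lt_le_trans/expR_gt0. Qed.

Lemma best_responseE g x : best_response g x = (partition_fun g)^-1 * gibbs g x.
Proof. by []. Qed.

Lemma best_response_gt0 g x : admissible g -> 0 < best_response g x.
Proof. by move=> ag; rewrite mulr_gt0 ?invr_gt0 ?partition_gt0 ?gibbs_gt0. Qed.

Lemma best_response_integ g : admissible g -> integ (best_response g).
Proof. by move=> ag; apply: integZ => //; exact: gibbs_integ. Qed.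

Lemma best_response_int1 g : admissible g -> \int[leb]_(x in M) best_response g x = 1.
Proof.
move=> ag; rewrite RintegralZl//; last exact: gibbs_integ.
by rewrite mulVf// gt_eqF// partition_gt0.
Qed.

(** One [C] comes from the Gibbs weight and one from its normalizing constant, which lies between
    [expR (- C)] and [expR C] because [expR (- U)] has integral 1. *)
Lemma best_response_bounds g x : admissible g -> M x ->
  expR (- (C *+ 2)) * expR (- U x) <= best_response g x <= expR (C *+ 2) * expR (- U x).
Proof.
move=> ag Mx; have Z0 := partition_gt0 ag.
have /andP[Z1 Z2] := partition_bounds ag; have /andP[g1 g2] := gibbs_bounds ag Mx.
rewrite best_responseE mulr2n opprD !expRD -!mulrA; apply/andP; split.
- apply: ler_pM => //; rewrite ?expR_ge0 ?mulr_ge0 ?expR_ge0//.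
  by rewrite expRN lef_pV2// posrE expR_gt0.
- apply: ler_pM => //; rewrite ?invr_ge0 ?(ltW Z0) ?expR_ge0//.
  by rewrite -[leRHS]invrK -expRN lef_pV2// posrE expR_gt0.
Qed.

Lemma ln_best_response g x : admissible g ->
  ln (best_response g x) = g x - U x - ln (partition_fun g).
Proof.
move=> ag; have Z0 := partition_gt0 ag.
by rewrite best_responseE lnM ?posrE ?invr_gt0 ?gibbs_gt0// lnV// expRK addrC.
Qed.

Lemma partition_le g g' e : admissible g -> admissible g' ->
  (forall x, M x -> `|g x - g' x| <= e) -> ln (partition_fun g) <= ln (partition_fun g') + e.
Proof.
move=> ag ag' gg'; have Z0 := partition_gt0 ag; have Z0' := partition_gt0 ag'.
rewrite -[e in leRHS](expRK e) -lnM ?posrE ?expR_gt0// ler_ln ?posrE ?mulr_gt0 ?expR_gt0//.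
rewrite mulrC -RintegralZl//; last exact: gibbs_integ.
apply: le_Rintegral => //; [exact: gibbs_integ|exact/integZ/gibbs_integ|].
move=> x Mx; rewrite -expRD ler_expR.
by have := le_trans (ler_norm _) (gg' x Mx); lra.
Qed.

Lemma ln_partition_dist g g' e : admissible g -> admissible g' ->
  (forall x, M x -> `|g x - g' x| <= e) ->
  `|ln (partition_fun g) - ln (partition_fun g')| <= e.
Proof.
move=> ag ag' gg'; have h1 := partition_le ag ag' gg'.
have h2 : ln (partition_fun g') <= ln (partition_fun g) + e.
  by apply: partition_le => // x Mx; rewrite distrC gg'.
move: h1 h2; move: (ln (partition_fun g)) (ln (partition_fun g')) => z z' h1 h2.
by rewrite ler_norml; apply/andP; split; lra.
Qed.

(** One [e] comes from the exponent and one from the logarithm of the partition function, which is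
    1-Lipschitz for the uniform distance. *)
Lemma ln_best_response_dist g g' e x : admissible g -> admissible g' ->
  (forall x, M x -> `|g x - g' x| <= e) -> M x ->
  `|ln (best_response g x) - ln (best_response g' x)| <= e *+ 2.
Proof.
move=> ag ag' gg' Mx; rewrite !ln_best_response//.
move: (ln_partition_dist ag ag' gg') (gg' x Mx).
move: (ln (partition_fun g)) (ln (partition_fun g')) (g x) (g' x) (U x) => z z' a a' u.
rewrite !ler_norml mulr2n => /andP[? ?] /andP[? ?]; apply/andP; split; lra.
Qed.

Section gibbs_variational.
Variable g : 'rV[R]_d -> R.
Hypothesis ag : admissible g.
Implicit Types p : 'rV[R]_d -> R.

(** Pointwise free energy identity: for [p] of mass 1 it integrates to the entropy relative to
    [expR (- U)], minus the mean of [g], plus the log-partition function. *)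
Lemma entropy_best_response p x : 0 <= p x ->
  p x * ln (p x / best_response g x) =
  p x * ln (p x / expR (- U x)) - (g x * p x - ln (partition_fun g) * p x).
Proof.
move=> p0; have Q0 := best_response_gt0 x ag.
rewrite (entropy_split p0 Q0 (expR_gt0 (- U x))).
rewrite (@ln_div _ (expR _)) ?posrE ?expR_gt0// expRK ln_best_response//.
by ring.
Qed.

Let gp_integ p : integ p -> integ (fun x => g x * p x - ln (partition_fun g) * p x).
Proof.
by move=> pi; apply: integB => //; [case: ag => mg gC; exact: integM_bounded mg gC pi|
  exact: integZ].
Qed.

Lemma potential_entropy_integ p : integ p -> (forall x, M x -> 0 <= p x) ->
  integ (fun x => p x * ln (p x / best_response g x)) ->
  integ (fun x => p x * ln (p x / expR (- U x))).
Proof.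
move=> pi p0 enti; apply: eq_integrable (integD mM enti (gp_integ pi)) => //.
by move=> x /set_mem Mx /=; rewrite entropy_best_response ?p0// subrK.
Qed.

Lemma best_response_entropy_int p : integ p -> (forall x, M x -> 0 <= p x) ->
  \int[leb]_(x in M) p x = 1 ->
  integ (fun x => p x * ln (p x / expR (- U x))) ->
  integ (fun x => p x * ln (p x / best_response g x)) /\
  \int[leb]_(x in M) (p x * ln (p x / best_response g x)) =
  \int[leb]_(x in M) (p x * ln (p x / expR (- U x))) -
  \int[leb]_(x in M) (g x * p x) + ln (partition_fun g).
Proof.
move=> pi p0 p1 enti; have gpi := integB mM enti (gp_integ pi); split.
  apply: eq_integrable gpi => // x /set_mem Mx /=.
  by rewrite entropy_best_response ?p0.
under eq_Rintegral => x /set_mem Mx do rewrite entropy_best_response ?p0//.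
have gi : integ (fun x => g x * p x).
  by case: ag => mg gC; exact: integM_bounded mg gC pi.
rewrite RintegralB//; last exact: gp_integ.
rewrite RintegralB//; last exact: integZ.
by rewrite RintegralZl// p1; ring.
Qed.

(* The best response maximizes [int g p - KL (p | exp (- U))], and the deficit
   of [p] is exactly its relative entropy to the best response. *)
Lemma gibbs_variational p p' :
  integ p -> (forall x, M x -> 0 <= p x) -> \int[leb]_(x in M) p x = 1 ->
  integ p' -> (forall x, M x -> 0 <= p' x) -> \int[leb]_(x in M) p' x = 1 ->
  integ (fun x => p x * ln (p x / expR (- U x))) ->
  integ (fun x => p' x * ln (p' x / expR (- U x))) ->
  \int[leb]_(x in M) (g x * (p' x - p x)) +
  (\int[leb]_(x in M) (p x * ln (p x / expR (- U x))) -
   \int[leb]_(x in M) (p' x * ln (p' x / expR (- U x)))) <=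
  \int[leb]_(x in M) (p x * ln (p x / best_response g x)).
Proof.
move=> pi p0 p1 pi' p0' p1' enti enti'.
have [_ ->] := best_response_entropy_int pi p0 p1 enti.
have [enti2 E] := best_response_entropy_int pi' p0' p1' enti'.
have := KL_ge0 mM pi' (best_response_integ ag) p0'
  (fun x _ => best_response_gt0 x ag).
rewrite p1' best_response_int1// => /(_ erefl).
rewrite (KL_Rintegral mM _ enti2) ?lee_fin ?E; last first.
  by move=> x _; exact: best_response_gt0.
case: ag => mg gC.
have -> : \int[leb]_(x in M) (g x * (p' x - p x)) =
    \int[leb]_(x in M) (g x * p' x) - \int[leb]_(x in M) (g x * p x).
  rewrite -RintegralB//; [|exact: integM_bounded mg gC pi'|exact: integM_bounded mg gC pi].
  by apply: eq_Rintegral => x _; rewrite mulrBr.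
lra.
Qed.

End gibbs_variational.

End best_response.

(** * Dissipation along the flow of one player *)

Section best_response_flow.
Context {R : realType} {d : nat} (M : set 'rV[R]_d) (U : 'rV[R]_d -> R).
Implicit Types (s t : R) (x : 'rV[R]_d).
Variables (C alpha : R) (g n : R -> 'rV[R]_d -> R).
Hypothesis mM : measurable M.
Hypothesis hU : is_potential M U.
Hypothesis alpha_gt0 : 0 < alpha.
Local Notation leb := (lebesgue_rV R d).
Local Notation integ f := (leb.-integrable M (EFin \o f)).
Local Notation Q t := (best_response M U (g t)).
Local Notation K := (expR (C *+ 2)).
Local Notation k := (expR (- (C *+ 2))).
Hypothesis ag : forall t, admissible M C (g t).
Hypothesis n_integ : forall t, 0 <= t -> integ (n t).
Hypothesis n_int1 : forall t, 0 <= t -> \int[leb]_(x in M) n t x = 1.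
Hypothesis n_ge0 : forall t x, 0 <= t -> M x -> 0 <= n t x.
Hypothesis n_ode : forall t x, 0 <= t -> M x ->
  derivative_ge0 (n ^~ x) t (alpha * (Q t x - n t x)).

Let Q_integ t : integ (Q t).
Proof. exact (best_response_integ mM hU (ag t)). Qed.

Let Q_gt0 t x : 0 < Q t x.
Proof. exact (best_response_gt0 mM hU x (ag t)). Qed.

Let Q_ge t x : M x -> k * expR (- U x) <= Q t x.
Proof. by move=> Mx; have /andP[] := best_response_bounds mM hU (ag t) Mx. Qed.

Let Q_le t x : M x -> Q t x <= K * expR (- U x).
Proof. by move=> Mx; have /andP[] := best_response_bounds mM hU (ag t) Mx. Qed.

Let mQ t : measurable_fun M (Q t).
Proof. exact: integ_measurable (Q_integ t). Qed.

Let mn t : 0 <= t -> measurable_fun M (n t).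
Proof. by move=> t0; exact: integ_measurable (n_integ t0). Qed.

Lemma flow_dist s t x : 0 <= s -> 0 <= t -> M x ->
  `|n s x - n t x| <= alpha * `|s - t| * (expR (alpha * t) * n t x + K * expR (- U x)).
Proof.
move=> s0 t0 Mx; apply: (@ode_dist _ _ _ (n ^~ x) (fun r => Q r x)) => //.
- by move=> r r0; exact: n_ode.
- by move=> r r0; rewrite (ltW (Q_gt0 r x)) Q_le.
- by move=> r r0; exact: n_ge0.
Qed.

Lemma flow_dist_int s t : 0 <= s -> 0 <= t ->
  \int[leb]_(x in M) `|n s x - n t x| <= alpha * (expR (alpha * t) + K) * `|s - t|.
Proof.
move=> s0 t0; have pi := potential_integ hU.
have bi : integ (fun x => expR (alpha * t) * n t x + K * expR (- U x)).
  by apply: integD => //; apply: integZ => //; exact: n_integ.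
apply: (@le_trans _ _ (\int[leb]_(x in M) (alpha * `|s - t| *
    (expR (alpha * t) * n t x + K * expR (- U x))))).
  apply: le_Rintegral => //.
  - by apply: integ_norm; apply: integB => //; exact: n_integ.
  - exact: integZ.
  - by move=> x Mx; exact: flow_dist.
rewrite RintegralZl// RintegralD//; last 2 first.
- by apply: integZ => //; exact: n_integ.
- exact: integZ.
rewrite RintegralZl//; last exact: n_integ.
by rewrite RintegralZl// n_int1// potential_int1//; lra.
Qed.

Lemma flow_lower t x : 0 <= t -> M x ->
  (1 - expR (- (alpha * t))) * (k * expR (- U x)) <= n t x.
Proof.
move=> t0 Mx.
have := @ode_lower _ alpha (k * expR (- U x)) (n ^~ x) (fun r => Q r x) alpha_gt0
  (fun r r0 => n_ode r0 Mx) (fun r r0 => Q_ge r Mx) t t0.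
by apply: le_trans; rewrite lerDr mulr_ge0 ?expR_ge0// n_ge0.
Qed.

Lemma flow_gt0 t x : 0 < t -> M x -> 0 < n t x.
Proof.
move=> t0 Mx; apply: lt_le_trans (flow_lower (ltW t0) Mx).
rewrite !mulr_gt0 ?expR_gt0// subr_gt0 -[ltRHS]expR0 ltr_expR oppr_lt0.
exact: mulr_gt0.
Qed.

Lemma flow_relative_bounds t : 0 < t -> exists A D : R, [/\ 0 <= A, 0 <= D,
  forall s x, M x -> Q s x <= A * n t x &
  forall s x, 0 <= s -> M x -> `|n s x - n t x| <= D * `|s - t| * n t x].
Proof.
move=> t0; set e := 1 - expR (- (alpha * t)).
have e0 : 0 < e.
  by rewrite subr_gt0 -[ltRHS]expR0 ltr_expR oppr_lt0 mulr_gt0.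
have ek0 : 0 < e * k by rewrite mulr_gt0 ?expR_gt0.
(* Upper bound on [Q] over lower bound on [n t], both relative to [expR (- U)]; it blows up as [t]
   tends to 0. *)
pose A := K / (e * k).
have A0 : 0 <= A by rewrite divr_ge0 ?expR_ge0// ltW.
have KA x : M x -> K * expR (- U x) <= A * n t x.
  move=> Mx; have := flow_lower (ltW t0) Mx; rewrite mulrA -(ler_pM2l ek0)//.
  rewrite -/e => nlow; rewrite /A.
  rewrite -mulrA ler_pM2l ?expR_gt0// mulrC ler_pdivlMr// mulrC.
  by move: (flow_lower (ltW t0) Mx); rewrite mulrA.
exists A, (alpha * (expR (alpha * t) + A)); split => //.
- by rewrite mulr_ge0 ?addr_ge0 ?expR_ge0// ltW.
- by move=> s x Mx; exact: le_trans (Q_le s Mx) (KA x Mx).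
- move=> s x s0 Mx; apply: (le_trans (flow_dist s0 (ltW t0) Mx)).
  have -> : alpha * (expR (alpha * t) + A) * `|s - t| * n t x =
      alpha * `|s - t| * (expR (alpha * t) * n t x + A * n t x) by ring.
  rewrite ler_wpM2l ?mulr_ge0 ?(ltW alpha_gt0)// lerD2l.
  exact: KA.
Qed.

Lemma flow_velocity_int0 t : 0 <= t ->
  \int[leb]_(x in M) (alpha * (Q t x - n t x)) = 0.
Proof.
move=> t0; rewrite RintegralZl//; last by apply: integB => //; exact: n_integ.
rewrite RintegralB//; last exact: n_integ.
by rewrite (best_response_int1 mM hU (ag t)) n_int1// subrr mulr0.
Qed.

Section derivative.
Variables (t L : R) (g' : 'rV[R]_d -> R).
Hypothesis t_gt0 : 0 < t.
Hypothesis L_ge0 : 0 <= L.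
Hypothesis g_lip : forall s x, 0 <= s -> M x -> `|g s x - g t x| <= L * `|s - t|.
Hypothesis g_quot : forall x, M x ->
  (g s x - g t x) / (s - t) @[s --> t^'] --> g' x.

Let near_t : \forall s \near t^', [/\ 0 < s, s != t & `|s - t| <= 1].
Proof.
have h1 : \forall s \near t^', 0 < s by apply: nbhs_dnbhs; exact: near_gt0.
have h2 : \forall s \near t^', s != t by exact: nbhs_dnbhs_neq.
have h3 : \forall s \near t^', `|s - t| <= 1.
  apply: nbhs_dnbhs; exists 1 => //= s /=.
  by rewrite distrC => /ltW.
by apply: filterS3 h1 h2 h3 => s; split.
Qed.

Let quotient_le (a b r : R) : r != 0 -> `|a| <= b * `|r| -> `|a / r| <= b.
Proof. by move=> r0 ab; rewrite normrM normfV ler_pdivrMr// normr_gt0. Qed.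

Let n_quot x : M x ->
  (n s x - n t x) / (s - t) @[s --> t^'] --> alpha * (Q t x - n t x).
Proof. by move=> Mx; apply: (derivative_ge0_quotient t_gt0); exact: n_ode (ltW t_gt0) Mx. Qed.

(** Allows the sign of the pairing of the two velocities to be read off finite differences. The
    quotient of [g] is bounded by [L] and that of [n] by [D * n t], which dominates the product. *)
Lemma flow_cross_term :
  \int[leb]_(x in M) ((g s x - g t x) * (n s x - n t x)) / (s - t) ^+ 2 @[s --> t^'] -->
  \int[leb]_(x in M) (g' x * (alpha * (Q t x - n t x))).
Proof.
have [A [D [A0 D0 QA nD]]] := flow_relative_bounds t_gt0.
pose f s x := (g s x - g t x) / (s - t) * ((n s x - n t x) / (s - t)).
have mgn s : 0 < s -> measurable_fun M (fun x => (g s x - g t x) / (s - t)).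
  by move=> s0; apply: measurable_funM => //; apply: measurable_funB; case: (ag s); case: (ag t).
have mnn s : 0 < s -> measurable_fun M (fun x => (n s x - n t x) / (s - t)).
  by move=> s0; apply: measurable_funM => //; apply: measurable_funB; apply: mn; exact: ltW.
have gb s x : 0 < s -> s != t -> M x -> `|(g s x - g t x) / (s - t)| <= L.
  by move=> s0 st Mx; apply: quotient_le; rewrite ?subr_eq0// g_lip// ltW.
have nb s x : 0 < s -> s != t -> M x -> `|(n s x - n t x) / (s - t)| <= D * n t x.
  move=> s0 st Mx; apply: quotient_le; rewrite ?subr_eq0//.
  by rewrite mulrAC nD// ltW.
have [_ f_cvg] : integ (fun x => g' x * (alpha * (Q t x - n t x))) /\
    \int[leb]_(x in M) f s x @[s --> t^'] -->
    \int[leb]_(x in M) (g' x * (alpha * (Q t x - n t x))).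
  apply: (@dominated_cvg_dnbhs _ _ _ leb M mM t f _ (fun x => L * (D * n t x))).
  - apply: filterS near_t => s [s0 st _]; split.
      by apply: measurable_funM; [exact: mgn|exact: mnn].
    by move=> x Mx; rewrite normrM ler_pM// ?gb ?nb.
  - by do 2 apply: integZ => //; exact: n_integ (ltW t_gt0).
  - by move=> x Mx; apply: cvgM; [exact: g_quot|exact: n_quot].
apply: cvg_trans f_cvg; apply: near_eq_cvg; apply: filterS near_t => s [s0 st _].
rewrite -RintegralZr//.
  apply: eq_Rintegral => x _; rewrite /f expr2 invfM; ring.
apply: (@le_integ _ _ _ leb M mM _ (fun x => (C + C) * `|n s x - n t x|)).
- apply: measurable_funM.
    by apply: measurable_funB; case: (ag s); case: (ag t).
  by apply: measurable_funB; apply: mn; exact: ltW.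
- move=> x Mx; rewrite normrM ler_wpM2r// (le_trans (ler_normB _ _))// lerD//.
    by case: (ag s) => _; exact.
  by case: (ag t) => _; exact.
- by apply/integZ/integ_norm/integB => //; apply: n_integ; exact: ltW.
Qed.

(** [g'] is known only as a pointwise limit on [M]; dominated convergence of the quotients times [h]
    yields measurability and integrability of the product at once. *)
Lemma flow_gradient_integ (h : 'rV[R]_d -> R) : integ h -> integ (fun x => g' x * h x).
Proof.
move=> hi.
have [] // := @dominated_cvg_dnbhs _ _ _ leb M mM t
  (fun s x => (g s x - g t x) / (s - t) * h x) (fun x => g' x * h x)
  (fun x => L * `|h x|).
- apply: filterS near_t => s [s0 st _]; split.
    apply: measurable_funM; last exact: integ_measurable hi.
    by apply: measurable_funM => //; apply: measurable_funB; case: (ag s); case: (ag t).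
  move=> x Mx; rewrite normrM ler_wpM2r//.
  by apply: quotient_le; rewrite ?subr_eq0// g_lip// ltW.
- exact/integZ/integ_norm.
- by move=> x Mx; apply: cvgM; [exact: g_quot|exact: cvg_cst].
Qed.

Let Z s := partition_fun M U (g s).

Lemma flow_partition_derive :
  is_derive t 1 Z (\int[leb]_(x in M) (g' x * gibbs U (g t) x)).
Proof.
apply: cvg_quotient_is_derive.
have gg s x : M x -> `|gibbs U (g s) x - gibbs U (g t) x| <=
    expR C * expR (- U x) * `|g s x - g t x|.
  move=> Mx; rewrite !gibbsE -mulrBl normrM (gtr0_norm (expR_gt0 (- U x))).
  rewrite [leRHS]mulrAC ler_pM2r ?expR_gt0//.
  (* The exponential is [expR C]-Lipschitz below [C]; only the larger exponent has to be bounded. *)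
  have expR_dist (a b : R) : b <= a -> `|a| <= C -> `|expR a - expR b| <= expR C * `|a - b|.
    move=> ba; rewrite ler_norml => /andP[_ aC].
    rewrite !ger0_norm ?subr_ge0 ?ler_expR//.
    have -> : expR a - expR b = expR a * (1 - expR (b - a)).
      by rewrite mulrBr mulr1 -expRD; congr (_ - expR _); ring.
    apply: ler_pM; rewrite ?expR_ge0 ?subr_ge0 ?ler_expR//.
      by rewrite -expR0 ler_expR subr_le0.
    by have := @expR_ge1Dx R (b - a); lra.
  have [ba|/ltW ab] := leP (g t x) (g s x).
    by apply: expR_dist => //; case: (ag s) => _; exact.
  rewrite distrC [in leRHS]distrC.
  by apply: expR_dist => //; case: (ag t) => _; exact.
pose f s x := (gibbs U (g s) x - gibbs U (g t) x) / (s - t).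
have fE s : \int[leb]_(x in M) f s x = (Z s - Z t) / (s - t).
  rewrite /f RintegralZr//; last by apply: integB => //; exact: gibbs_integ.
  by rewrite RintegralB//; exact: gibbs_integ.
have -> : (fun s => (Z s - Z t) / (s - t)) = (fun s => \int[leb]_(x in M) f s x).
  by apply/funext => s; rewrite fE.
have [] // := @dominated_cvg_dnbhs _ _ _ leb M mM t f
  (fun x => g' x * gibbs U (g t) x) (fun x => expR C * L * expR (- U x)).
- apply: filterS near_t => s [s0 st _]; split.
    apply: measurable_funM => //; apply: measurable_funB;
      exact: integ_measurable (gibbs_integ mM hU (ag _)).
  move=> x Mx; apply: quotient_le; first by rewrite subr_eq0.
  apply: (le_trans (gg s x Mx)).
  have -> : expR C * L * expR (- U x) * `|s - t| =
    expR C * expR (- U x) * (L * `|s - t|) by ring.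
  by rewrite ler_wpM2l ?mulr_ge0 ?expR_ge0// g_lip// ltW.
- by apply: integZ => //; exact: potential_integ.
- move=> x Mx; apply: is_derive_quotient.
  have dg : is_derive t 1 (fun s => g s x) (g' x).
    by apply: cvg_quotient_is_derive; exact: g_quot.
  have dB : is_derive t 1 (fun s => g s x - U x) (g' x - 0) by exact: is_deriveB.
  have dE := @is_derive1_comp _ expR (fun s => g s x - U x) t _ _ (is_derive_expR _) dB.
  by apply: (is_derive_eq dE); rewrite subr0 mulrC.
Qed.

Let ent s x := n s x * ln (n s x / Q s x).

Let J := \int[leb]_(x in M) ((n t x - Q t x) * ln (n t x / Q t x)).

(** The three terms are [n' ln (n / Q)], then [n (ln n)'], which is [n'] and has zero integral, and
    [- n (ln Q)'], where [ln Q] is [g - U - ln Z]. *)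
Let ent_quot x : M x ->
  (ent s x - ent t x) / (s - t) @[s --> t^'] -->
  alpha * (Q t x - n t x) * ln (n t x / Q t x) + alpha * (Q t x - n t x) -
  n t x * (g' x - (Z t)^-1 * \int[leb]_(x in M) (g' x * gibbs U (g t) x)).
Proof.
move=> Mx; set dZ := \int[leb]_(x in M) _; have nt0 := flow_gt0 t_gt0 Mx.
have Z0 : 0 < Z t by exact: (partition_gt0 mM hU (ag t)).
have dn : is_derive t 1 (fun s => n s x) (alpha * (Q t x - n t x)).
  by apply: cvg_quotient_is_derive; exact: n_quot.
have dg : is_derive t 1 (fun s => g s x) (g' x).
  by apply: cvg_quotient_is_derive; exact: g_quot.
have dlnn : is_derive t 1 (fun s => ln (n s x)) ((n t x)^-1 * (alpha * (Q t x - n t x))).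
  exact: (@is_derive1_comp _ (@ln R) (fun s => n s x) t _ _ (is_derive1_ln nt0) dn).
have dlnZ : is_derive t 1 (fun s => ln (Z s)) ((Z t)^-1 * dZ).
  exact: (@is_derive1_comp _ (@ln R) Z t _ _ (is_derive1_ln Z0) flow_partition_derive).
(* The logarithm of the ratio splits into differentiable pieces where [n s x] is positive, that is
   for [s > 0]; this suffices near [t]. *)
pose phi s := n s x * (ln (n s x) - (g s x - U x - ln (Z s))).
have entE s : 0 < s -> ent s x = phi s.
  move=> s0; rewrite /ent ln_div ?posrE ?flow_gt0//.
  by rewrite (ln_best_response mM hU x (ag s)).
have dgU : is_derive t 1 (fun s => g s x - U x) (g' x - 0) by exact: is_deriveB.
have dQ : is_derive t 1 (fun s => g s x - U x - ln (Z s)) (g' x - 0 - (Z t)^-1 * dZ).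
  exact: is_deriveB.
have dln : is_derive t 1 (fun s => ln (n s x) - (g s x - U x - ln (Z s)))
    ((n t x)^-1 * (alpha * (Q t x - n t x)) - (g' x - 0 - (Z t)^-1 * dZ)).
  exact: is_deriveB.
have dphi : is_derive t 1 phi
  (alpha * (Q t x - n t x) * ln (n t x / Q t x) + alpha * (Q t x - n t x) -
   n t x * (g' x - (Z t)^-1 * dZ)).
  apply: (is_derive_eq (is_deriveM dn dln)).
  rewrite ln_div ?posrE// (ln_best_response mM hU x (ag t)) -/(Z t) /GRing.scale/=.
  move: (Z t) Z0 => z z0.
  by field; rewrite ?(gt_eqF nt0) ?(gt_eqF z0).
apply: cvg_trans (is_derive_quotient dphi); apply: near_eq_cvg.
by apply: filterS near_t => s [s0 st _]; rewrite !entE.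
Qed.

(** Integrability at [t] propagates to nearby times, since the increments of [ent] are dominated by
    a function built from [ent t] and [n t]. *)
Lemma flow_entropy_derive : integ (ent t) ->
  [/\ \forall s \near t, integ (ent s),
      integ (fun x => Q t x * ln (n t x / Q t x)) &
      is_derive t 1 (fun s => \int[leb]_(x in M) ent s x)
        (- (alpha * J) - \int[leb]_(x in M) (g' x * (n t x - Q t x)))].
Proof.
move=> enti; have [A [D [A0 D0 QA nD]]] := flow_relative_bounds t_gt0.
have ti := n_integ (ltW t_gt0).
have ment s : 0 < s -> measurable_fun M (ent s).
  by move=> s0; apply: measurable_entropy => //; apply: mn; exact: ltW.
(* From [entropy_lipschitz], with relative increment [D] |s - t| of [n] and increment [L *+ 2] times
   |s - t| of [ln Q]; as |s - t| is at most 1, the factor containing it is replaced by [1 + D]. *)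
pose B x := D * `|ent t x| + (1 + D) * (D + L *+ 2) * n t x.
have Bi : integ B by apply: integD; [|apply/integZ/integ_norm|exact: integZ].
have entB s x : 0 < s -> `|s - t| <= 1 -> M x -> `|ent s x - ent t x| <= B x * `|s - t|.
  move=> s0 st1 Mx; have nt0 := flow_gt0 t_gt0 Mx.
  have gd : `|ln (Q s x) - ln (Q t x)| <= (L * `|s - t|) *+ 2.
    apply: (ln_best_response_dist mM hU (ag s) (ag t)) => // y My.
    by apply: g_lip => //; exact: ltW.
  have := @entropy_lipschitz _ (n t x) (n s x) (Q t x) (Q s x) (D * `|s - t|)
    ((L * `|s - t|) *+ 2) nt0 (flow_gt0 s0 Mx) (Q_gt0 t x) (Q_gt0 s x)
    (nD s x (ltW s0) Mx) gd.
  move=> /le_trans; apply; rewrite /B /ent normrM (gtr0_norm nt0).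
  set l := `|ln _|; set r := `|s - t|.
  have r0 : 0 <= r by exact: normr_ge0.
  have -> : (D * (n t x * l) + (1 + D) * (D + L *+ 2) * n t x) * r =
      n t x * (D * r * l + (1 + D) * (D * r + (L * r) *+ 2)).
    by rewrite !mulr2n; ring.
  rewrite ler_pM2l// lerD2l ler_wpM2r//.
    by rewrite addr_ge0 ?mulrn_wge0 ?mulr_ge0.
  by rewrite lerD2l ler_piMr.
have ent_integ s : 0 < s -> `|s - t| <= 1 -> integ (ent s).
  move=> s0 st1; apply: (@le_integ _ _ _ leb M mM _ (fun x => B x + `|ent t x|)).
  - exact: ment.
  - move=> x Mx; have := entB s x s0 st1 Mx.
    have : B x * `|s - t| <= B x.
      rewrite ler_piMr// /B addr_ge0 ?mulr_ge0 ?addr_ge0 ?mulrn_wge0//.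
      by apply: n_ge0 => //; exact: ltW.
    have := ler_normD (ent s x - ent t x) (ent t x); rewrite subrK.
    by lra.
  - by apply: integD => //; exact: integ_norm.
(* [Q t <= A * n t] carries integrability over to the reversed relative entropy. *)
have lni : integ (fun x => Q t x * ln (n t x / Q t x)).
  apply: (@le_integ _ _ _ leb M mM _ (fun x => A * `|ent t x|)).
  - apply: measurable_funM => //; apply: measurable_ln_ratio => //.
    exact: mn (ltW t_gt0).
  - move=> x Mx; have nt0 := flow_gt0 t_gt0 Mx.
    rewrite normrM (gtr0_norm (Q_gt0 t x)) /ent normrM (gtr0_norm nt0) mulrA.
    by rewrite ler_wpM2r// QA.
  - exact/integZ/integ_norm.
split => //.
  have h1 : \forall s \near t, 0 < s by exact: near_gt0.
  have h3 : \forall s \near t, `|s - t| <= 1.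
    by exists 1 => //= s /=; rewrite distrC => /ltW.
  by apply: filterS2 h1 h3 => s; exact: ent_integ.
apply: cvg_quotient_is_derive.
pose f s x := (ent s x - ent t x) / (s - t).
set dZ := \int[leb]_(x in M) (g' x * gibbs U (g t) x).
pose l x := alpha * (Q t x - n t x) * ln (n t x / Q t x) + alpha * (Q t x - n t x) -
   n t x * (g' x - (Z t)^-1 * dZ).
have [_ q_cvg] : integ l /\ \int[leb]_(x in M) f s x @[s --> t^'] --> \int[leb]_(x in M) l x.
  apply: (@dominated_cvg_dnbhs _ _ _ leb M mM t f l B) => //.
  apply: filterS near_t => s [s0 st st1]; split.
    by apply: measurable_funM => //; apply: measurable_funB; exact: ment.
  by move=> x Mx; apply: quotient_le; rewrite ?subr_eq0// entB.
have lE : \int[leb]_(x in M) l x =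
    - (alpha * J) - \int[leb]_(x in M) (g' x * (n t x - Q t x)).
  have Ji : integ (fun x => (n t x - Q t x) * ln (n t x / Q t x)).
    have := integB mM enti lni; congr (_.-integrable _ (EFin \o _)).
    by apply/funext => x; rewrite /ent mulrBl.
  have g'n := flow_gradient_integ ti; have g'Q := flow_gradient_integ (Q_integ t).
  (* The logarithmic derivative of [Z] is the mean of [g'] under [Q t]; as [n t] has mass 1,
     subtracting it replaces [n t] by [n t - Q t] in the last integral. *)
  pose c := (Z t)^-1 * dZ.
  have cE : c = \int[leb]_(x in M) (g' x * Q t x).
    rewrite /c -RintegralZl//; last by apply: flow_gradient_integ; exact: gibbs_integ.
    by apply: eq_Rintegral => x _; rewrite mulrCA.
  have -> : l = (fun x => - alpha * ((n t x - Q t x) * ln (n t x / Q t x)) +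
      alpha * (Q t x - n t x) - (g' x * n t x - c * n t x)).
    by apply/funext => x; rewrite /l /c; ring.
  have i1 : integ (fun x => - alpha * ((n t x - Q t x) * ln (n t x / Q t x))) by exact: integZ.
  have i2 : integ (fun x => alpha * (Q t x - n t x)) by apply/integZ/integB.
  have i3 : integ (fun x => c * n t x) by exact: integZ.
  rewrite RintegralB//; [|exact: integD|exact: integB].
  rewrite RintegralD// (flow_velocity_int0 (ltW t_gt0)) RintegralZl//.
  rewrite RintegralB// RintegralZl// n_int1 ?(ltW t_gt0)// mulr1 cE -/J.
  have -> : \int[leb]_(x in M) (g' x * (n t x - Q t x)) =
      \int[leb]_(x in M) (g' x * n t x) - \int[leb]_(x in M) (g' x * Q t x).
    by rewrite -RintegralB//; apply: eq_Rintegral => x _; rewrite mulrBr.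
  by ring.
rewrite -lE; apply: cvg_trans q_cvg; apply: near_eq_cvg.
apply: filterS near_t => s [s0 st st1].
have si := ent_integ s s0 st1.
rewrite /f RintegralZr//; last exact: integB.
by rewrite RintegralB.
Qed.

Lemma flow_KL_derive : (KL M (n t) (Q t) < +oo)%E ->
  [/\ \forall s \near t, KL M (n s) (Q s) \is a fin_num,
      is_derive t 1 (fun s => fine (KL M (n s) (Q s)))
        (- (alpha * J) - \int[leb]_(x in M) (g' x * (n t x - Q t x))) &
      Jeffreys M (n t) (Q t) = J%:E].
Proof.
move=> KLoo; have ti := n_integ (ltW t_gt0).
have n0 x : M x -> 0 <= n t x by apply: n_ge0; exact: ltW.
have enti := KL_integ mM ti (Q_integ t) n0 (fun x _ => Q_gt0 t x) KLoo.
have [near_i lni dent] := flow_entropy_derive enti; split.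
- by apply: filterS near_i => s si; rewrite KL_Rintegral.
- rewrite (_ : (fun s => fine _) = (fun s => \int[leb]_(x in M) ent s x))//.
  by apply/funext => s; rewrite KL_integral.
- rewrite /Jeffreys KL_Rintegral//.
  have nt0 x : M x -> 0 < n t x by exact: flow_gt0.
  have lnE x : M x -> - (Q t x * ln (n t x / Q t x)) = Q t x * ln (Q t x / n t x).
    by move=> Mx; rewrite -mulrN !ln_div ?posrE ?nt0// opprB.
  have Qlni : integ (fun x => Q t x * ln (Q t x / n t x)).
    apply: eq_integrable (integZ mM (-1) lni) => // x /set_mem Mx /=.
    by rewrite mulN1r lnE.
  rewrite KL_Rintegral// -EFinD; congr EFin.
  rewrite -RintegralD//; apply: eq_Rintegral => x /set_mem Mx.
  by rewrite -lnE// mulrBl.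
Qed.

End derivative.

Section initial_time.
Variable L : R.
Hypothesis g_lip : forall s x, 0 <= s -> M x -> `|g s x - g 0 x| <= L * s.

(* [n s] is a convex combination of [n 0] and of a density lying between two
   multiples of [expR (- U)]; convexity of the relative entropy then replaces its
   differentiability, which may fail at time [0]. *)
Lemma flow_KL_initial s : (KL M (n 0) (Q 0) < +oo)%E -> 0 < s ->
  (KL M (n s) (Q s) <= (expR (- (alpha * s)) * (fine (KL M (n 0%R) (Q 0%R)) + L * s *+ 2) +
    (1 - expR (- (alpha * s))) * (C *+ 4))%:E)%E.
Proof.
move=> KLoo s0; have i0 := n_integ (lexx 0); have si := n_integ (ltW s0).
have n00 x : M x -> 0 <= n 0 x by exact: n_ge0.
have ent0 := KL_integ mM i0 (Q_integ 0) n00 (fun x _ => Q_gt0 0 x) KLoo.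
rewrite (KL_Rintegral mM (fun x _ => Q_gt0 0 x) ent0) /= KL_integral//.
set e := expR (- (alpha * s)).
have e1 : 0 < 1 - e by rewrite subr_gt0 -[ltRHS]expR0 ltr_expR oppr_lt0 mulr_gt0.
have e0 : 0 < e by exact: expR_gt0.
pose r x := (n s x - e * n 0 x) / (1 - e).
have rE x : (1 - e) * r x = n s x - e * n 0 x by rewrite mulrC divfK// gt_eqF.
have r_lo x : M x -> k * expR (- U x) <= r x.
  move=> Mx; rewrite ler_pdivlMr// mulrC.
  have := @ode_lower _ alpha (k * expR (- U x)) (n ^~ x) (fun r => Q r x) alpha_gt0
    (fun r r0 => n_ode r0 Mx) (fun r r0 => Q_ge r Mx) s (ltW s0).
  by rewrite -/e; lra.
have r_up x : M x -> r x <= K * expR (- U x).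
  move=> Mx; rewrite ler_pdivrMr// mulrC.
  have := @ode_upper _ alpha (K * expR (- U x)) (n ^~ x) (fun r => Q r x) alpha_gt0
    (fun r r0 => n_ode r0 Mx) (fun r r0 => Q_le r Mx) s (ltW s0).
  by rewrite -/e; lra.
have r_gt0 x : M x -> 0 < r x.
  by move=> Mx; apply: lt_le_trans (r_lo x Mx); rewrite mulr_gt0 ?expR_gt0.
(* The ratio [r / Q] is at most [K / k], the exponential of [C *+ 4]. *)
have r_ent x : M x -> r x * ln (r x / Q s x) <= r x * (C *+ 4).
  move=> Mx; have rx0 := r_gt0 x Mx; have rq0 := divr_gt0 rx0 (Q_gt0 s x).
  rewrite (ler_pM2l rx0) -[leRHS]expRK ler_ln ?posrE ?expR_gt0//.
  rewrite ler_pdivrMr ?Q_gt0//; apply: (le_trans (r_up x Mx)).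
  apply: le_trans (ler_wpM2l (expR_ge0 _) (Q_ge s Mx)).
  by rewrite -!expRD ler_expR !mulrS mulr0n; lra.
have n0_ent x : M x ->
    n 0 x * ln (n 0 x / Q s x) <= n 0 x * ln (n 0 x / Q 0 x) + n 0 x * (L * s *+ 2).
  move=> Mx; rewrite (entropy_split (n00 x Mx) (Q_gt0 s x) (Q_gt0 0 x)) lerD2l.
  rewrite ler_wpM2l ?n00// ln_div ?posrE ?Q_gt0//.
  have := ln_best_response_dist mM hU (ag s) (ag 0) (fun y => g_lip (ltW s0)) Mx.
  by rewrite distrC; apply: le_trans; exact: ler_norm.
(* Pointwise majorant of the entropy whose integral is exactly the claimed bound, [n 0] and [n s]
   having mass 1. *)
pose h x := e * (n 0 x * ln (n 0 x / Q 0 x) + n 0 x * (L * s *+ 2)) +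
  (n s x - e * n 0 x) * (C *+ 4).
have ent_h x : M x -> n s x * ln (n s x / Q s x) <= h x.
  move=> Mx; have := @entropy_convex _ (n 0 x) (r x) (Q s x) (1 - e) (n00 x Mx)
    (r_gt0 x Mx) (Q_gt0 s x).
  have -> : 1 - (1 - e) = e by ring.
  have -> : e * n 0 x + (1 - e) * r x = n s x by rewrite rE; ring.
  move=> /(_ _)/le_trans; apply; first by rewrite !ltW//=; lra.
  rewrite /h; apply: lerD; first by apply: ler_wpM2l; [exact: ltW|exact: n0_ent].
  by rewrite -rE -[leRHS]mulrA; apply: ler_wpM2l; [exact: ltW|exact: r_ent].
have i1 : integ (fun x => n 0 x * (L * s *+ 2)).
  apply: eq_integrable (integZ mM (L * s *+ 2) i0) => // x _ /=.
  by rewrite mulrC.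
have i2 : integ (fun x => n s x - e * n 0 x) by apply: integB => //; exact: integZ.
have i3 : integ (fun x => (n s x - e * n 0 x) * (C *+ 4)).
  apply: eq_integrable (integZ mM (C *+ 4) i2) => // x _ /=.
  by rewrite mulrC.
have i4 := integD mM ent0 i1.
have hi : integ h by apply: integD => //; exact: integZ.
have hE : \int[leb]_(x in M) h x =
    e * (\int[leb]_(x in M) (n 0 x * ln (n 0 x / Q 0 x)) + L * s *+ 2) +
    (1 - e) * (C *+ 4).
  rewrite /h RintegralD//; last exact: integZ.
  rewrite RintegralZl// RintegralD// !RintegralZr// RintegralB//; last exact: integZ.
  by rewrite RintegralZl// !n_int1// ?(ltW s0)// mulr1 mul1r.
rewrite -hE /Rintegral fineK; last exact: integrable_fin_num hi.
have enti : integ (fun x => n s x * ln (n s x / Q s x)).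
  apply: (@le_integ _ _ _ leb M mM _ (fun x => `|h x| + `|n s x - Q s x|)).
  - by apply: measurable_entropy => //; exact: mn (ltW s0).
  - move=> x Mx; have := ent_h x Mx.
    have := entropy_ge (n_ge0 (ltW s0) Mx) (Q_gt0 s x).
    have := ler_norm (h x); have := ler_norm (- (n s x - Q s x)); rewrite normrN.
    have := normr_ge0 (h x); have := normr_ge0 (n s x - Q s x).
    by rewrite ler_norml => *; apply/andP; split; lra.
  - by apply: integD => //; apply: integ_norm => //; exact: integB.
by apply: le_integral => // x /set_mem Mx; rewrite lee_fin ent_h.
Qed.

End initial_time.

End best_response_flow.

(** * Flat derivatives along the flow *)

Section density_path.
Context {R : realType} {d : nat} (M : set 'rV[R]_d).
Implicit Types (s : R) (x : 'rV[R]_d).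
Hypothesis mM : measurable M.
Local Notation leb := (lebesgue_rV R d).
Local Notation integ f := (leb.-integrable M (EFin \o f)).
Variables (m : R -> prob_on M) (p : R -> 'rV[R]_d -> R) (t : R).
Variables (b p' : 'rV[R]_d -> R).
Hypothesis t_gt0 : 0 < t.
Hypothesis mp : forall s, 0 <= s -> is_density (m s) (p s).
Hypothesis b_integ : integ b.
Hypothesis p_dist : forall s x, 0 <= s -> M x -> `|p s x - p t x| <= b x * `|s - t|.
Hypothesis p_quot : forall x, M x -> (p s x - p t x) / (s - t) @[s --> t^'] --> p' x.

Let near_t : \forall s \near t^', 0 < s /\ s != t.
Proof.
have h1 : \forall s \near t^', 0 < s by apply: nbhs_dnbhs; exact: near_gt0.
have h2 : \forall s \near t^', s != t by exact: nbhs_dnbhs_neq.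
by apply: filterS2 h1 h2 => s; split.
Qed.

Let p_integ s : 0 <= s -> integ (p s).
Proof. by move=> /mp; exact: is_density_integ. Qed.

Let t_ge0 : 0 <= t. Proof. exact: ltW. Qed.

Lemma density_path_dist s : 0 <= s ->
  \int[leb]_(x in M) `|p s x - p t x| <= (\int[leb]_(x in M) b x) * `|s - t|.
Proof.
move=> s0; rewrite -RintegralZr//; apply: le_Rintegral => //.
- by apply: integ_norm; apply: integB => //; exact: p_integ.
- by apply: eq_integrable (integZ mM `|s - t| b_integ) => // x _ /=; rewrite mulrC.
- by move=> x Mx; exact: p_dist.
Qed.

(** The function [e] is arbitrary because it will be the intermediate point of [flat_mean_value]. As
    [clamp01] is at most 1, the estimate of the distance from [m s] to [m t] also covers the
    mixture. *)
Lemma density_path_Rintegral_mix (e : R -> R) (f : 'rV[R]_d -> R) :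
  measurable_fun M f -> bounded_on M f ->
  \int[mix (e s) (m t) (m s)]_(x in M) f x @[s --> t^'] --> \int[m t]_(x in M) f x.
Proof.
move=> mf [C fC].
have C0 : 0 <= C by have [x /fC] := prob_on_nonempty (m t); exact: le_trans.
set B := \int[leb]_(x in M) b x.
have dist_le s : 0 <= s ->
    `|\int[mix (e s) (m t) (m s)]_(x in M) f x - \int[m t]_(x in M) f x| <=
    C * (B * `|s - t|).
  move=> s0; rewrite (Rintegral_mix mM)//; last by exists C.
  rewrite addrC addKr normrM.
  have := int_diff_le mM (mp t_ge0) (mp s0) mf fC => dle.
  apply: (@le_trans _ _ (1 * `|int_diff (m t) (m s) f|)).
    rewrite ler_wpM2r// ger0_norm ?clamp01_ge0//.
    by have := clamp01_le1 (e s); rewrite subr_ge0.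
  rewrite mul1r (le_trans dle)// ler_wpM2l//.
  exact: density_path_dist.
have bnd_cvg : C * (B * `|s - t|) @[s --> t^'] --> (0 : R).
  have -> : (0 : R) = C * (B * `|t - t|) by rewrite subrr normr0 !mulr0.
  apply: cvgM; first exact: cvg_cst.
  apply: cvgM; first exact: cvg_cst.
  apply: cvg_norm; apply: cvgB; last exact: cvg_cst.
  exact: nbhs_dnbhs.
apply/cvgrPdist_lt => eps eps0.
move/cvgrPdist_lt : bnd_cvg => /(_ eps eps0) bnd.
apply: filterS2 near_t bnd => s [s0 _]; rewrite sub0r normrN => bnd_s.
have {}bnd_s := le_lt_trans (ler_norm _) bnd_s.
by rewrite distrC; exact: (le_lt_trans (dist_le s (ltW s0)) bnd_s).
Qed.

Lemma density_path_mix_cvg (e : R -> R) : mix (e s) (m t) (m s) @[s --> t^'] --> m t.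
Proof.
apply: cvg_prob_on => f cf bf; apply: density_path_Rintegral_mix => //.
exact: within_continuous_measurable.
Qed.

Lemma density_path_cvg : m s @[s --> t^'] --> m t.
Proof.
apply: cvg_prob_on => f cf bf.
have mf := within_continuous_measurable mM cf.
apply: cvg_trans (density_path_Rintegral_mix (fun=> 1) mf bf).
apply: near_eq_cvg; apply: nearW => s.
by rewrite (Rintegral_mix mM)// clamp01_id ?ler01 ?lexx// mul1r addrC subrK.
Qed.

Lemma density_path_int_diff (H : R -> 'rV[R]_d -> R) (H0 : 'rV[R]_d -> R) C :
  (forall s, measurable_fun M (H s)) -> (forall s x, M x -> `|H s x| <= C) ->
  (forall x, M x -> H s x @[s --> t^'] --> H0 x) ->
  int_diff (m t) (m s) (H s) / (s - t) @[s --> t^'] -->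
  \int[leb]_(x in M) (H0 x * p' x).
Proof.
move=> mH HC HH0.
pose f s x := H s x * ((p s x - p t x) / (s - t)).
have [_ f_cvg] : integ (fun x => H0 x * p' x) /\
    \int[leb]_(x in M) f s x @[s --> t^'] --> \int[leb]_(x in M) (H0 x * p' x).
  apply: (@dominated_cvg_dnbhs _ _ _ leb M mM t f _ (fun x => C * b x)).
  - apply: filterS near_t => s [s0 st]; split.
      apply: measurable_funM => //; apply: measurable_funM => //.
      by apply: measurable_funB; apply: integ_measurable (p_integ _) => //; exact: ltW.
    move=> x Mx; rewrite normrM ler_pM// ?HC// normrM normfV.
    by rewrite ler_pdivrMr ?normr_gt0 ?subr_eq0// p_dist// ltW.
  - exact: integZ.
  - by move=> x Mx; apply: cvgM; [exact: HH0|exact: p_quot].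
apply: cvg_trans f_cvg; apply: near_eq_cvg; apply: filterS near_t => s [s0 st].
rewrite (int_diffE mM (mp t_ge0) (mp (ltW s0)) (mH s) (HC s)) -RintegralZr//.
  by apply: eq_Rintegral => x _; rewrite /f mulrA.
apply: (integM_bounded mM (mH s) (HC s)).
by apply: integB => //; apply: p_integ => //; exact: ltW.
Qed.

(** Chain rule along a path of measures. The functional depends on [s] so that it can carry the
    moving measure of the other player; the derivative must converge along arbitrary mixtures
    because of the mean value theorem. *)
Lemma density_path_flat (G : R -> prob_on M -> R)
    (dG : R -> prob_on M -> 'rV[R]_d -> R) (d0 : 'rV[R]_d -> R) C :
  (forall s, flat_derivative (G s) (dG s)) ->
  (forall s m0 x, M x -> `|dG s m0 x| <= C) ->
  (forall (e : R -> R) x, M x ->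
    dG s (mix (e s) (m t) (m s)) x @[s --> t^'] --> d0 x) ->
  (G s (m s) - G s (m t)) / (s - t) @[s --> t^'] -->
  \int[leb]_(x in M) (d0 x * p' x).
Proof.
move=> hG dGC dGd0.
have /choice[e eE] : forall s, exists e,
    G s (m s) - G s (m t) = int_diff (m t) (m s) (dG s (mix e (m t) (m s))).
  by move=> s; exact: (flat_mean_value mM (hG s) (dGC s)).
under eq_fun do rewrite eE.
apply: (density_path_int_diff (C := C)).
- by move=> s; exact: (flat_derivative_measurable mM (hG s)).
- by move=> s x Mx; exact: dGC.
- by move=> x Mx; exact: dGd0.
Qed.

End density_path.

Section two_density_paths.
Context {R : realType} {d : nat} (X Y : set 'rV[R]_d).
Implicit Types (s : R) (x y : 'rV[R]_d).
Hypotheses (mX : measurable X) (mY : measurable Y).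
Local Notation leb := (lebesgue_rV R d).
Variables (nu : R -> prob_on X) (mu : R -> prob_on Y) (n m : R -> 'rV[R]_d -> R).
Hypothesis nuP : forall s, 0 <= s -> is_density (nu s) (n s).
Hypothesis muP : forall s, 0 <= s -> is_density (mu s) (m s).
Variables (G : prob_on X -> prob_on Y -> R).
Variables (GX GY : prob_on X -> prob_on Y -> 'rV[R]_d -> R) (CX CY : R).
Hypothesis hGX : forall b, flat_derivative (G ^~ b) (GX ^~ b).
Hypothesis hGY : forall a, flat_derivative (G a) (GY a).
Hypothesis GXC : forall a b x, X x -> `|GX a b x| <= CX.
Hypothesis GYC : forall a b y, Y y -> `|GY a b y| <= CY.

Lemma two_paths_dist s t : 0 <= s -> 0 <= t ->
  `|G (nu s) (mu s) - G (nu t) (mu t)| <=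
  CX * \int[leb]_(x in X) `|n s x - n t x| + CY * \int[leb]_(y in Y) `|m s y - m t y|.
Proof.
move=> s0 t0.
have -> : G (nu s) (mu s) - G (nu t) (mu t) =
  (G (nu s) (mu t) - G (nu t) (mu t)) + (G (nu s) (mu s) - G (nu s) (mu t)) by ring.
rewrite (le_trans (ler_normD _ _))// lerD//.
- exact: (flat_lipschitz mX (hGX (mu t)) (fun a x => @GXC a (mu t) x) (nuP t0) (nuP s0)).
- exact: (flat_lipschitz mY (hGY (nu s)) (@GYC (nu s)) (muP t0) (muP s0)).
Qed.

Variables (t : R) (bX bY n' m' : 'rV[R]_d -> R).
Hypothesis t_gt0 : 0 < t.
Hypothesis bX_integ : leb.-integrable X (EFin \o bX).
Hypothesis bY_integ : leb.-integrable Y (EFin \o bY).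
Hypothesis n_dist : forall s x, 0 <= s -> X x -> `|n s x - n t x| <= bX x * `|s - t|.
Hypothesis m_dist : forall s y, 0 <= s -> Y y -> `|m s y - m t y| <= bY y * `|s - t|.
Hypothesis n_quot : forall x, X x -> (n s x - n t x) / (s - t) @[s --> t^'] --> n' x.
Hypothesis m_quot : forall y, Y y -> (m s y - m t y) / (s - t) @[s --> t^'] --> m' y.
Hypothesis GY_joint : forall (e : R -> R) y, Y y ->
  GY (nu s) (mix (e s) (mu t) (mu s)) y @[s --> t^'] --> GY (nu t) (mu t) y.

(* The intermediate point is [(nu s, mu t)]: the derivative in the second
   argument, jointly continuous in both measures, is the one evaluated at a
   moving first argument. *)
Lemma two_paths_quotient :
  (G (nu s) (mu s) - G (nu t) (mu t)) / (s - t) @[s --> t^'] -->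
  \int[leb]_(x in X) (GX (nu t) (mu t) x * n' x) +
  \int[leb]_(y in Y) (GY (nu t) (mu t) y * m' y).
Proof.
have -> : (fun s => (G (nu s) (mu s) - G (nu t) (mu t)) / (s - t)) =
    (fun s => (G (nu s) (mu t) - G (nu t) (mu t)) / (s - t) +
              (G (nu s) (mu s) - G (nu s) (mu t)) / (s - t)).
  by apply/funext => s; ring.
apply: cvgD.
- apply: (density_path_flat (G := fun=> G ^~ (mu t)) (dG := fun=> GX ^~ (mu t))
    (C := CX) mX t_gt0 nuP bX_integ n_dist n_quot) => //.
  + by move=> _ a x Xx; exact: GXC.
  + move=> e x Xx; have [cG _ _ _] := hGX (mu t).
    apply: (@cvg_joint _ _ _ X (GX ^~ (mu t)) _ _
      (fun s => mix (e s) (nu t) (nu s)) (fun=> x)) => //; [exact: nearW| |exact: cvg_cst].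
    exact: (density_path_mix_cvg mX t_gt0 nuP bX_integ n_dist).
- apply: (density_path_flat (G := fun s => G (nu s)) (dG := fun s => GY (nu s))
    (C := CY) mY t_gt0 muP bY_integ m_dist m_quot) => //.
  by move=> s b y Yy; exact: GYC.
Qed.

End two_density_paths.

(** * The game *)

Section nikaido_isoda.
Context {R : realType} {d : nat} (X Y : set 'rV[R]_d).
Hypotheses (mX : measurable X) (mY : measurable Y).
Local Notation leb := (lebesgue_rV R d).

Lemma KLm_is_density (M : set 'rV[R]_d) (m : prob_on M) (p q : 'rV[R]_d -> R) :
  measurable M -> is_density m p -> measurable_fun M q -> KLm m q = KL M p q.
Proof.
move=> mM mp mq; have ac := is_density_abs_cont mM mp.
rewrite /KLm asboolT//; apply: eq_KL_ae => //.
- exact: measurable_density.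
- by case: mp.
- exact: density_ae_eq.
- by apply: aeW.
Qed.

(** Separates the deviations of infinite entropy, which cannot be profitable, from those to which
    [gibbs_variational] applies. *)
Lemma KLm_potentialP (M : set 'rV[R]_d) (U : 'rV[R]_d -> R) (m : prob_on M) :
  measurable M -> is_potential M U ->
  KLm m (fun x => expR (- U x)) = +oo%E \/
  exists p, [/\ is_density m p,
    leb.-integrable M (EFin \o (fun x => p x * ln (p x / expR (- U x)))) &
    KLm m (fun x => expR (- U x)) =
      (\int[leb]_(x in M) (p x * ln (p x / expR (- U x))))%:E].
Proof.
move=> mM hU; have [ac|nac] := pselect (abs_cont m); last first.
  by left; rewrite /KLm asboolF.
have [p mp] := abs_cont_density ac.
have mU := integ_measurable (potential_integ hU).
rewrite (KLm_is_density mM mp mU).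
have [KLoo|] := ltP (KL M p (fun x => expR (- U x))) +oo%E; last first.
  by rewrite leye_eq => /eqP; left.
have enti := KL_integ mM (is_density_integ mM mp) (potential_integ hU)
  (fun x Mx => (let: And3 _ p0 _ := mp in p0 x Mx)) (fun x _ => expR_gt0 (- U x)) KLoo.
by right; exists p; split => //; rewrite KL_Rintegral// => x _; exact: expR_gt0.
Qed.

(** Passes from the scaled derivative in the best response to the flat derivative in the convexity
    inequalities; bounds on [dF] are recovered from those on [g] through [c^-1]. *)
Lemma int_diff_scaled (M : set 'rV[R]_d) (C : R) (g dF : 'rV[R]_d -> R) (c : R)
    (m1 m2 : prob_on M) p1 p2 : measurable M -> c != 0 ->
  admissible M C g -> (forall x, g x = c * dF x) ->
  is_density m1 p1 -> is_density m2 p2 ->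
  \int[leb]_(x in M) (g x * (p2 x - p1 x)) = c * int_diff m1 m2 dF.
Proof.
move=> mM c0 [mg gC] gE mp1 mp2.
have dFE x : dF x = c^-1 * g x by rewrite gE mulrA mulVf ?mul1r.
have mdF : measurable_fun M dF.
  rewrite (_ : dF = fun x => c^-1 * g x); last by apply/funext.
  exact: measurable_funM.
have dFC x : M x -> `|dF x| <= `|c^-1| * C.
  by move=> Mx; rewrite dFE normrM ler_wpM2l// gC.
rewrite (int_diffE mM mp1 mp2 mdF dFC) -RintegralZl//.
  by apply: eq_Rintegral => x _; rewrite gE mulrA.
have pi := integB mM (is_density_integ mM mp2) (is_density_integ mM mp1).
exact: (integM_bounded mM mdF dFC pi).
Qed.

Variables (sigma : R) (Upi Urho : 'rV[R]_d -> R).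
Hypothesis sigma_gt0 : 0 < sigma.
Hypotheses (hUpi : is_potential X Upi) (hUrho : is_potential Y Urho).
Variable F : prob_on X -> prob_on Y -> R.
Variables dF_nu dF_mu : prob_on X -> prob_on Y -> 'rV[R]_d -> R.
Hypothesis hF : convex_concave F dF_nu dF_mu.
Variables (CX CY : R) (nu : prob_on X) (mu : prob_on Y) (n m : 'rV[R]_d -> R).
Let gX x := - (2 / sigma ^+ 2) * dF_nu nu mu x.
Let gY y := 2 / sigma ^+ 2 * dF_mu nu mu y.
Hypothesis agX : admissible X CX gX.
Hypothesis agY : admissible Y CY gY.
Hypothesis nuP : is_density nu n.
Hypothesis muP : is_density mu m.
Let QX := best_response X Upi gX.
Let QY := best_response Y Urho gY.

Let lam := sigma ^+ 2 / 2.
Let lam_gt0 : 0 < lam. Proof. by rewrite divr_gt0 ?exprn_gt0. Qed.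

(** Convexity-concavity replaces a gain in [F] by its linearization at [(nu, mu)], to which
    [gibbs_variational] applies; [lam] undoes the scaling [2 / sigma ^+ 2]. The payoff at [(nu, mu)]
    cancels between the bounds on the supremum and on the infimum. *)
Lemma NI_le : (KL X n QX < +oo)%E -> (KL Y m QY < +oo)%E ->
  (NI sigma Upi Urho F nu mu <= lam%:E * (KL X n QX + KL Y m QY))%E.
Proof.
move=> KX KY.
have [ni mi] := (is_density_integ mX nuP, is_density_integ mY muP).
have n0 x : X x -> 0 <= n x by case: nuP => _ + _; exact.
have m0 y : Y y -> 0 <= m y by case: muP => _ + _; exact.
have QX0 x : X x -> 0 < QX x by move=> _; exact: (best_response_gt0 mX hUpi x agX).
have QY0 y : Y y -> 0 < QY y by move=> _; exact: (best_response_gt0 mY hUrho y agY).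
have entX := KL_integ mX ni (best_response_integ mX hUpi agX) n0 QX0 KX.
have entY := KL_integ mY mi (best_response_integ mY hUrho agY) m0 QY0 KY.
have entX' := potential_entropy_integ mX hUpi agX ni n0 entX.
have entY' := potential_entropy_integ mY hUrho agY mi m0 entY.
have mUpi := integ_measurable (potential_integ hUpi).
have mUrho := integ_measurable (potential_integ hUrho).
have KLnu : KLm nu (fun x => expR (- Upi x)) =
    (\int[leb]_(x in X) (n x * ln (n x / expR (- Upi x))))%:E.
  rewrite (KLm_is_density mX nuP mUpi).
  exact: (KL_Rintegral mX (fun x _ => expR_gt0 (- Upi x)) entX').
have KLmu : KLm mu (fun x => expR (- Urho x)) =
    (\int[leb]_(x in Y) (m x * ln (m x / expR (- Urho x))))%:E.
  rewrite (KLm_is_density mY muP mUrho).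
  exact: (KL_Rintegral mY (fun y _ => expR_gt0 (- Urho y)) entY').
rewrite (KL_Rintegral mX QX0 entX) (KL_Rintegral mY QY0 entY).
have := gibbs_variational mX hUpi agX ni n0 (is_density_int1 mX nuP).
have := gibbs_variational mY hUrho agY mi m0 (is_density_int1 mY muP).
rewrite -/QX -/QY.
move: (\int[leb]_(x in X) (n x * ln (n x / QX x))) => kX.
move: (\int[leb]_(x in Y) (m x * ln (m x / QY x))) => kY.
move: KLnu; set a := \int[leb]_(x in X) _ => KLnu.
move: KLmu; set b := \int[leb]_(x in Y) _ => KLmu gvY gvX.
have c0 : 2 / sigma ^+ 2 != 0 by rewrite mulf_neq0 ?invr_eq0 ?expf_neq0 ?pnatr_eq0 ?gt_eqF.
have lamc : lam * (2 / sigma ^+ 2) = 1.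
  by rewrite /lam; field; rewrite gt_eqF.
have sup_le mu' : (payoff sigma Upi Urho F nu mu' <= (F nu mu + lam * (a - b) + lam * kY)%:E)%E.
  (* The entropy of [nu] is finite, so a deviation of infinite entropy has payoff [-oo]. *)
  rewrite /payoff KLnu; have [->|[p [mup enti ->]]] := KLm_potentialP mu' mY hUrho.
    by rewrite (_ : (a%:E - +oo = -oo)%E)// mulrNy gtr0_sg// mul1e leNye.
  rewrite -EFinB -EFinM -EFinD lee_fin.
  have p0 y : Y y -> 0 <= p y by case: mup => _ + _; exact.
  have := gvY p (is_density_integ mY mup) p0 (is_density_int1 mY mup) entY' enti.
  rewrite (int_diff_scaled mY c0 agY (fun=> erefl) muP mup).
  move: (\int[leb]_(y in Y) _) => b' h.
  have := ler_wpM2l (ltW lam_gt0) h; rewrite mulrDr mulrA lamc mul1r => {}h.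
  by have [_ /(_ nu mu mu')] := hF; rewrite -/lam; lra.
have inf_ge nu' : ((F nu mu + lam * (a - b) - lam * kX)%:E <= payoff sigma Upi Urho F nu' mu)%E.
  rewrite /payoff KLmu; have [->|[p [nup enti ->]]] := KLm_potentialP nu' mX hUpi.
    by rewrite (_ : (+oo - b%:E = +oo)%E)// mulry gtr0_sg// mul1e leey.
  rewrite -EFinB -EFinM -EFinD lee_fin.
  have p0 x : X x -> 0 <= p x by case: nup => _ + _; exact.
  have := gvX p (is_density_integ mX nup) p0 (is_density_int1 mX nup) entX' enti.
  have cN0 : - (2 / sigma ^+ 2) != 0 by rewrite oppr_eq0.
  rewrite (int_diff_scaled mX cN0 agX (fun=> erefl) nuP nup).
  move: (\int[leb]_(x in X) _) => a' h.
  have := ler_wpM2l (ltW lam_gt0) h; rewrite mulrDr mulrA mulrN lamc mulN1r => {}h.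
  by have [/(_ nu nu' mu) + _] := hF; rewrite -/lam; lra.
rewrite /NI -EFinD -EFinM.
apply: (@le_trans _ _ ((F nu mu + lam * (a - b) + lam * kY)%:E -
    (F nu mu + lam * (a - b) - lam * kX)%:E)%E).
  apply: leeB; first by apply: ge_ereal_sup => _ [mu' _ <-]; exact: sup_le.
  by apply: le_ereal_inf_tmp => _ [nu' _ <-]; exact: inf_ge.
by rewrite -EFinB lee_fin; lra.
Qed.

End nikaido_isoda.

Lemma ge0_adde_fin_num (R : realDomainType) (a b : \bar R) :
  (0 <= a)%E -> (0 <= b)%E -> (a + b < +oo)%E -> a \is a fin_num /\ b \is a fin_num.
Proof. by case: a => [a| |]; case: b => [b| |]. Qed.

Lemma fin_num_lty (R : realDomainType) (a : \bar R) : a \is a fin_num -> (a < +oo)%E.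
Proof. by case: a => // r _; exact: ltry. Qed.

Lemma ge0_fine_le (R : realDomainType) (a : \bar R) (r : R) :
  (0 <= a)%E -> (a <= r%:E)%E -> fine a <= r.
Proof. by case: a. Qed.

(** * Dissipation and exponential decay for the coupled flow *)

Section best_response_dynamics.
Context {R : realType} {d : nat} (X Y : set 'rV[R]_d).
Hypotheses (mX : measurable X) (mY : measurable Y).
Local Notation leb := (lebesgue_rV R d).
Variables (Upi Urho : 'rV[R]_d -> R).
Hypotheses (hUpi : is_potential X Upi) (hUrho : is_potential Y Urho).
Variables (sigma alpha : R).
Hypotheses (sigma_gt0 : 0 < sigma) (alpha_gt0 : 0 < alpha).
Variable F : prob_on X -> prob_on Y -> R.
Variables dF_nu dF_mu : prob_on X -> prob_on Y -> 'rV[R]_d -> R.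
Variables d2F_nunu d2F_munu d2F_mumu d2F_numu :
  prob_on X -> prob_on Y -> 'rV[R]_d -> 'rV[R]_d -> R.
Hypothesis hdF : first_flat_derivatives F dF_nu dF_mu.
Hypothesis hF : convex_concave F dF_nu dF_mu.
Variables C_nu C_mu C_nunu C_mumu C_numu C_munu : R.
Hypotheses (C_nunu_ge0 : 0 <= C_nunu) (C_mumu_ge0 : 0 <= C_mumu).
Hypotheses (C_numu_ge0 : 0 <= C_numu) (C_munu_ge0 : 0 <= C_munu).
Hypothesis dF_nuC : forall a b x, X x -> `|dF_nu a b x| <= C_nu.
Hypothesis dF_muC : forall a b y, Y y -> `|dF_mu a b y| <= C_mu.
Hypothesis hd2F : second_flat_derivatives dF_nu dF_mu
  d2F_nunu d2F_munu d2F_mumu d2F_numu.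
Hypothesis d2F_nunuC : forall a b x x', X x -> X x' -> `|d2F_nunu a b x x'| <= C_nunu.
Hypothesis d2F_mumuC : forall a b y y', Y y -> Y y' -> `|d2F_mumu a b y y'| <= C_mumu.
Hypothesis d2F_numuC : forall a b y x, Y y -> X x -> `|d2F_numu a b y x| <= C_numu.
Hypothesis d2F_munuC : forall a b x y, X x -> Y y -> `|d2F_munu a b x y| <= C_munu.
Variables (nu : R -> prob_on X) (mu : R -> prob_on Y) (n m : R -> 'rV[R]_d -> R).
Hypothesis nuP : forall t, 0 <= t -> is_density (nu t) (n t).
Hypothesis muP : forall t, 0 <= t -> is_density (mu t) (m t).
Local Notation c := (2 / sigma ^+ 2).
Let gX t x := - c * dF_nu (nu t) (mu t) x.
Let gY t y := c * dF_mu (nu t) (mu t) y.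
Let QX t := best_response X Upi (gX t).
Let QY t := best_response Y Urho (gY t).
Hypothesis n_ode : forall t x, 0 <= t -> X x ->
  derivative_ge0 (n ^~ x) t (alpha * (QX t x - n t x)).
Hypothesis m_ode : forall t y, 0 <= t -> Y y ->
  derivative_ge0 (m ^~ y) t (alpha * (QY t y - m t y)).

Let c_gt0 : 0 < c. Proof. by rewrite divr_gt0 ?exprn_gt0. Qed.

Let CX := c * C_nu.
Let CY := c * C_mu.

Let agX t : admissible X CX (gX t).
Proof.
split.
  apply: measurable_funM => //.
  exact: (flat_derivative_measurable mX (hdF.1 (mu t)) (nu t)).
move=> x Xx; rewrite normrM normrN (gtr0_norm c_gt0).
by apply: ler_wpM2l; [exact: ltW|exact: dF_nuC].
Qed.

Let agY t : admissible Y CY (gY t).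
Proof.
split.
  apply: measurable_funM => //.
  exact: (flat_derivative_measurable mY (hdF.2 (nu t)) (mu t)).
move=> x Yx; rewrite normrM (gtr0_norm c_gt0).
by apply: ler_wpM2l; [exact: ltW|exact: dF_muC].
Qed.

Let n_integ t (t0 : 0 <= t) := is_density_integ mX (nuP t0).
Let m_integ t (t0 : 0 <= t) := is_density_integ mY (muP t0).
Let n_int1 t (t0 : 0 <= t) := is_density_int1 mX (nuP t0).
Let m_int1 t (t0 : 0 <= t) := is_density_int1 mY (muP t0).
Let n_ge0 t x : 0 <= t -> X x -> 0 <= n t x.
Proof. by move=> t0; case: (nuP t0) => _ + _; exact. Qed.
Let m_ge0 t y : 0 <= t -> Y y -> 0 <= m t y.
Proof. by move=> t0; case: (muP t0) => _ + _; exact. Qed.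

Let bX t x := alpha * (expR (alpha * t) * n t x + expR (CX *+ 2) * expR (- Upi x)).
Let bY t y := alpha * (expR (alpha * t) * m t y + expR (CY *+ 2) * expR (- Urho y)).

Let bX_integ t : 0 <= t -> leb.-integrable X (EFin \o bX t).
Proof.
move=> t0; apply: integZ => //; apply: integD => //; apply: integZ => //.
  exact: n_integ.
exact: potential_integ hUpi.
Qed.

Let bY_integ t : 0 <= t -> leb.-integrable Y (EFin \o bY t).
Proof.
move=> t0; apply: integZ => //; apply: integD => //; apply: integZ => //.
  exact: m_integ.
exact: potential_integ hUrho.
Qed.

Let n_dist s t x : 0 <= s -> 0 <= t -> X x -> `|n s x - n t x| <= bX t x * `|s - t|.
Proof.
move=> s0 t0 Xx; rewrite /bX mulrAC.
exact: (flow_dist mX hUpi alpha_gt0 agX n_ge0 n_ode).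
Qed.

Let m_dist s t y : 0 <= s -> 0 <= t -> Y y -> `|m s y - m t y| <= bY t y * `|s - t|.
Proof.
move=> s0 t0 Yy; rewrite /bY mulrAC.
exact: (flow_dist mY hUrho alpha_gt0 agY m_ge0 m_ode).
Qed.

Let n_dist_int := flow_dist_int mX hUpi alpha_gt0 agX n_integ n_int1 n_ge0 n_ode.
Let m_dist_int := flow_dist_int mY hUrho alpha_gt0 agY m_integ m_int1 m_ge0 m_ode.

Let nunu_flat x b : X x -> flat_derivative (fun a => dF_nu a b x) (fun a => d2F_nunu a b x).
Proof. by move=> Xx; case: hd2F => + _ _ _; exact. Qed.
Let mumu_flat y a : Y y -> flat_derivative (fun b => dF_mu a b y) (fun b => d2F_mumu a b y).
Proof. by move=> Yy; case: hd2F => _ + _ _; exact. Qed.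
Let munu_flat x a : X x -> flat_derivative (fun b => dF_nu a b x) (fun b => d2F_munu a b x).
Proof. by move=> Xx; case: hd2F => _ _ + _ => /(_ x Xx)[+ _]; exact. Qed.
Let numu_flat y b : Y y -> flat_derivative (fun a => dF_mu a b y) (fun a => d2F_numu a b y).
Proof. by move=> Yy; case: hd2F => _ _ _ /(_ y Yy)[+ _]; exact. Qed.

(** The second order bounds make each gradient Lipschitz for the integral distance of densities, and
    the densities are Lipschitz in time at [t] with constants [A] and [B]. The sum [LX + LY] serves
    both players. *)
Lemma gradient_lipschitz t : 0 <= t -> exists L, [/\ 0 <= L,
  forall s x, 0 <= s -> X x -> `|gX s x - gX t x| <= L * `|s - t| &
  forall s y, 0 <= s -> Y y -> `|gY s y - gY t y| <= L * `|s - t|].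
Proof.
move=> t0; pose A := alpha * (expR (alpha * t) + expR (CX *+ 2)).
pose B := alpha * (expR (alpha * t) + expR (CY *+ 2)).
have A0 : 0 <= A by rewrite mulr_ge0 ?addr_ge0 ?expR_ge0// ltW.
have B0 : 0 <= B by rewrite mulr_ge0 ?addr_ge0 ?expR_ge0// ltW.
pose LX := c * (C_nunu * A + C_munu * B); pose LY := c * (C_mumu * B + C_numu * A).
have LX0 : 0 <= LX.
  by apply: mulr_ge0; [exact: ltW|apply: addr_ge0; exact: mulr_ge0].
have LY0 : 0 <= LY.
  by apply: mulr_ge0; [exact: ltW|apply: addr_ge0; exact: mulr_ge0].
exists (LX + LY); split; first exact: addr_ge0.
- move=> s x s0 Xx; rewrite /gX -mulrBr normrM normrN (gtr0_norm c_gt0).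
  have dle := two_paths_dist mX mY nuP muP (fun b => nunu_flat b Xx)
    (fun a => munu_flat a Xx) (fun a b x' => @d2F_nunuC a b x x' Xx)
    (fun a b y => @d2F_munuC a b x y Xx) s0 t0.
  apply: (@le_trans _ _ (LX * `|s - t|)); last by rewrite ler_wpM2r// lerDl.
  rewrite /LX -mulrA; apply: ler_wpM2l; first exact: ltW.
  apply: (le_trans dle); rewrite mulrDl -!mulrA lerD//.
    by apply: ler_wpM2l => //; rewrite mulrA; exact: n_dist_int.
  by apply: ler_wpM2l => //; rewrite mulrA; exact: m_dist_int.
- move=> s y s0 Yy; rewrite /gY -mulrBr normrM (gtr0_norm c_gt0).
  have dle := @two_paths_dist _ _ _ _ mY mX mu nu m n muP nuP (fun b a => dF_mu a b y)
    (fun b a => d2F_mumu a b y) (fun b a => d2F_numu a b y) _ _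
    (fun a => mumu_flat a Yy) (fun b => numu_flat b Yy)
    (fun b a y' => @d2F_mumuC a b y y' Yy) (fun b a x => @d2F_numuC a b y x Yy) s t s0 t0.
  apply: (@le_trans _ _ (LY * `|s - t|)); last by rewrite ler_wpM2r// lerDr.
  rewrite /LY -mulrA; apply: ler_wpM2l; first exact: ltW.
  apply: (le_trans dle); rewrite mulrDl -!mulrA lerD//.
    by apply: ler_wpM2l => //; rewrite mulrA; exact: m_dist_int.
  by apply: ler_wpM2l => //; rewrite mulrA; exact: n_dist_int.
Qed.

(** [two_paths_quotient] is applied with the space variable frozen. For the second player the two
    measures exchange roles, so that the derivative evaluated at a moving pair is again the mixed
    one. *)
Lemma gradient_quotient t : 0 < t -> exists gX' gY' : 'rV[R]_d -> R,
  (forall x, X x -> (gX s x - gX t x) / (s - t) @[s --> t^'] --> gX' x) /\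
  (forall y, Y y -> (gY s y - gY t y) / (s - t) @[s --> t^'] --> gY' y).
Proof.
move=> t0; have t_ge0 := ltW t0.
have bXi := bX_integ t_ge0; have bYi := bY_integ t_ge0.
have nd s x (s0 : 0 <= s) : X x -> `|n s x - n t x| <= bX t x * `|s - t|.
  exact: n_dist.
have md s y (s0 : 0 <= s) : Y y -> `|m s y - m t y| <= bY t y * `|s - t|.
  exact: m_dist.
have nq x : X x -> (n s x - n t x) / (s - t) @[s --> t^'] --> alpha * (QX t x - n t x).
  by move=> Xx; apply: (derivative_ge0_quotient t0); exact: n_ode t_ge0 Xx.
have mq y : Y y -> (m s y - m t y) / (s - t) @[s --> t^'] --> alpha * (QY t y - m t y).
  by move=> Yy; apply: (derivative_ge0_quotient t0); exact: m_ode t_ge0 Yy.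
have nu_cvg := density_path_cvg mX t0 nuP bXi nd.
have mu_cvg := density_path_cvg mY t0 muP bYi md.
have nu_mix := density_path_mix_cvg mX t0 nuP bXi nd.
have mu_mix := density_path_mix_cvg mY t0 muP bYi md.
(* Existence is stated at every point, with a dummy value off [X], in order to apply [choice]. *)
have X_quot x : exists l : R, X x -> (gX s x - gX t x) / (s - t) @[s --> t^'] --> l.
  have [Xx|nXx] := pselect (X x); last by exists 0.
  have munu_cont : {within [set z : prob_on X * prob_on Y * 'rV[R]_d | Y z.2],
      continuous (fun z => d2F_munu z.1.1 z.1.2 x z.2)}.
    by case: hd2F => _ _ + _ => /(_ x Xx)[].
  have := two_paths_quotient mX mY nuP muP (fun b => nunu_flat b Xx)
    (fun a => munu_flat a Xx) (fun a b x' => @d2F_nunuC a b x x' Xx)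
    (fun a b y => @d2F_munuC a b x y Xx) t0 bXi bYi nd md nq mq _.
  set l := \int[leb]_(x0 in X) _ + _ => dF_cvg.
  exists (- c * l) => _.
  have -> : (fun s => (gX s x - gX t x) / (s - t)) = (fun s =>
      - c * ((dF_nu (nu s) (mu s) x - dF_nu (nu t) (mu t) x) / (s - t))).
    by apply/funext => s; rewrite /gX -mulrBr mulrA.
  apply: cvgM; [exact: cvg_cst|apply: dF_cvg => e y Yy].
  apply: (@cvg_joint _ _ _ Y (fun p => d2F_munu p.1 p.2 x) _ _
    (fun s => (nu s, mix (e s) (mu t) (mu s))) (fun=> y) (nu t, mu t) y) => //.
  - exact: nearW.
  - exact: (@cvg_pair _ _ _ t^' (nbhs (nu t)) (nbhs (mu t)) _ _ _ nu _ nu_cvg (mu_mix e)).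
  - exact: cvg_cst.
have Y_quot y : exists l : R, Y y -> (gY s y - gY t y) / (s - t) @[s --> t^'] --> l.
  have [Yy|nYy] := pselect (Y y); last by exists 0.
  have numu_cont : {within [set z : prob_on X * prob_on Y * 'rV[R]_d | X z.2],
      continuous (fun z => d2F_numu z.1.1 z.1.2 y z.2)}.
    by case: hd2F => _ _ _ /(_ y Yy)[].
  have := @two_paths_quotient _ _ _ _ mY mX mu nu m n muP nuP (fun b a => dF_mu a b y)
    (fun b a => d2F_mumu a b y) (fun b a => d2F_numu a b y) _ _
    (fun a => mumu_flat a Yy) (fun b => numu_flat b Yy)
    (fun b a y' => @d2F_mumuC a b y y' Yy) (fun b a x => @d2F_numuC a b y x Yy)
    t _ _ _ _ t0 bYi bXi md nd mq nq _.
  set l := \int[leb]_(x0 in Y) _ + _ => dF_cvg.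
  exists (c * l) => _.
  have -> : (fun s => (gY s y - gY t y) / (s - t)) = (fun s =>
      c * ((dF_mu (nu s) (mu s) y - dF_mu (nu t) (mu t) y) / (s - t))).
    by apply/funext => s; rewrite /gY -mulrBr mulrA.
  apply: cvgM; [exact: cvg_cst|apply: dF_cvg => e x Xx].
  apply: (@cvg_joint _ _ _ X (fun p => d2F_numu p.1 p.2 y) _ _
    (fun s => (mix (e s) (nu t) (nu s), mu s)) (fun=> x) (nu t, mu t) x) => //.
  - exact: nearW.
  - exact: (@cvg_pair _ _ _ t^' (nbhs (nu t)) (nbhs (mu t)) _ _ _ _ mu (nu_mix e) mu_cvg).
  - exact: cvg_cst.
have [gX' gX'P] := choice X_quot; have [gY' gY'P] := choice Y_quot.
by exists gX', gY'; split => [x Xx|y Yy]; [exact: gX'P|exact: gY'P].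
Qed.

(* Convexity-concavity makes [(dF_nu, - dF_mu)] a monotone operator. *)
Lemma gradient_monotone s t : 0 <= s -> 0 <= t ->
  \int[leb]_(x in X) ((gX s x - gX t x) * (n s x - n t x)) +
  \int[leb]_(y in Y) ((gY s y - gY t y) * (m s y - m t y)) <= 0.
Proof.
move=> s0 t0.
have c0 : c != 0 by rewrite gt_eqF.
have cN0 : - c != 0 by rewrite oppr_eq0.
have split_int (M : set 'rV[R]_d) (C : R) (g g' h : 'rV[R]_d -> R) : measurable M ->
    admissible M C g -> admissible M C g' -> leb.-integrable M (EFin \o h) ->
    \int[leb]_(x in M) ((g x - g' x) * h x) =
    \int[leb]_(x in M) (g x * h x) - \int[leb]_(x in M) (g' x * h x).
  move=> mM [mg gC] [mg' gC'] hi; rewrite -RintegralB//.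
  - by apply: eq_Rintegral => x _; rewrite mulrBl.
  - exact: (integM_bounded mM mg gC hi).
  - exact: (integM_bounded mM mg' gC' hi).
rewrite (split_int _ _ _ _ _ mX (agX s) (agX t) (integB mX (n_integ s0) (n_integ t0))).
rewrite (split_int _ _ _ _ _ mY (agY s) (agY t) (integB mY (m_integ s0) (m_integ t0))).
rewrite (int_diff_scaled mX cN0 (agX s) (fun=> erefl) (nuP t0) (nuP s0)).
rewrite (int_diff_scaled mX cN0 (agX t) (fun=> erefl) (nuP t0) (nuP s0)).
rewrite (int_diff_scaled mY c0 (agY s) (fun=> erefl) (muP t0) (muP s0)).
rewrite (int_diff_scaled mY c0 (agY t) (fun=> erefl) (muP t0) (muP s0)).
have int_diffC (M : set 'rV[R]_d) (a b : prob_on M) f : int_diff a b f = - int_diff b a f.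
  by rewrite /int_diff opprB.
have [hX hY] := hF.
(* Linearizations at both times in each measure: in the sum of the convexity inequalities minus the
   concavity ones, the values of [F] at the four pairs cancel. *)
have h1 := hX (nu t) (nu s) (mu t); have h2 := hX (nu s) (nu t) (mu s).
have h3 := hY (nu t) (mu t) (mu s); have h4 := hY (nu s) (mu s) (mu t).
rewrite (int_diffC _ (nu s) (nu t)) in h2; rewrite (int_diffC _ (mu s) (mu t)) in h4.
move: h1 h2 h3 h4.
move: (int_diff (nu t) (nu s) (dF_nu (nu t) (mu t))) => a_t.
move: (int_diff (nu t) (nu s) (dF_nu (nu s) (mu s))) => a_s.
move: (int_diff (mu t) (mu s) (dF_mu (nu t) (mu t))) => b_t.
move: (int_diff (mu t) (mu s) (dF_mu (nu s) (mu s))) => b_s h1 h2 h3 h4.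
have : 0 <= c * (a_s - a_t - b_s + b_t) by apply: mulr_ge0; [exact: ltW|lra].
by move: c => r; lra.
Qed.

Let L s : \bar R := KL_to_BR sigma Upi Urho dF_nu dF_mu (nu s) (mu s).

Let QX_gt0 s x : 0 < QX s x.
Proof. exact (best_response_gt0 mX hUpi x (agX s)). Qed.
Let QY_gt0 s y : 0 < QY s y.
Proof. exact (best_response_gt0 mY hUrho y (agY s)). Qed.
Let QX_integ s := best_response_integ mX hUpi (agX s).
Let QY_integ s := best_response_integ mY hUrho (agY s).

Let KLX s := KL X (n s) (QX s).
Let KLY s := KL Y (m s) (QY s).

Let eq_KL_density (M : set 'rV[R]_d) (a : prob_on M) p q : measurable M ->
  is_density a p -> measurable_fun M q ->
  KL M (density a) q = KL M p q /\ KL M q (density a) = KL M q p.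
Proof.
move=> mM ap mq; have mp : measurable_fun M p by case: ap.
have mda := measurable_density (is_density_abs_cont mM ap).
have ae_p := density_ae_eq mM ap; have ae_q : ae_eq leb M q q by exact: aeW.
by split; apply: eq_KL_ae.
Qed.

Let LE s : 0 <= s -> L s = (KLX s + KLY s)%E.
Proof.
move=> s0; have [KX _] := eq_KL_density mX (nuP s0) (integ_measurable (QX_integ s)).
have [KY _] := eq_KL_density mY (muP s0) (integ_measurable (QY_integ s)).
by rewrite /KLX /KLY /QX /QY -KX -KY.
Qed.

Let KLX_ge0 s : 0 <= s -> (0 <= KLX s)%E.
Proof.
move=> s0; apply: (KL_ge0 mX (n_integ s0) (QX_integ s)
  (fun x => @n_ge0 s x s0) (fun x _ => QX_gt0 s x)).
by rewrite (n_int1 s0) (best_response_int1 mX hUpi (agX s)).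
Qed.

Let KLY_ge0 s : 0 <= s -> (0 <= KLY s)%E.
Proof.
move=> s0; apply: (KL_ge0 mY (m_integ s0) (QY_integ s)
  (fun y => @m_ge0 s y s0) (fun y _ => QY_gt0 s y)).
by rewrite (m_int1 s0) (best_response_int1 mY hUrho (agY s)).
Qed.

Let L_fin s : 0 <= s -> (L s < +oo)%E -> KLX s \is a fin_num /\ KLY s \is a fin_num.
Proof.
move=> s0; rewrite (LE s0).
exact: (ge0_adde_fin_num (KLX_ge0 s0) (KLY_ge0 s0)).
Qed.

Lemma KL_to_BR_derive t : 0 < t -> (L t < +oo)%E -> exists J dL,
  [/\ \forall s \near t, L s \is a fin_num,
      is_derive t 1 (fun s => fine (L s)) dL,
      Jeffreys_to_BR sigma Upi Urho dF_nu dF_mu (nu t) (mu t) = J%:E,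
      dL <= - (alpha * J) & fine (L t) <= J].
Proof.
move=> t0 Lt; have t_ge0 := ltW t0.
have [KXfin KYfin] := L_fin t_ge0 Lt.
have KXoo := fin_num_lty KXfin.
have KYoo := fin_num_lty KYfin.
have [LL [LL0 gX_lip gY_lip]] := gradient_lipschitz t_ge0.
have [gX' [gY' [gX_quot gY_quot]]] := gradient_quotient t0.
have [nearX dX JX] := flow_KL_derive mX hUpi alpha_gt0 agX n_integ n_int1 n_ge0 n_ode
  t0 LL0 gX_lip gX_quot KXoo.
have [nearY dY JY] := flow_KL_derive mY hUrho alpha_gt0 agY m_integ m_int1 m_ge0 m_ode
  t0 LL0 gY_lip gY_quot KYoo.
have crossX := flow_cross_term mX hUpi alpha_gt0 agX n_integ n_ge0 n_ode t0 gX_lip gX_quot.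
have crossY := flow_cross_term mY hUrho alpha_gt0 agY m_integ m_ge0 m_ode t0 gY_lip gY_quot.
have gX'i := flow_gradient_integ mX agX t0 gX_lip gX_quot
  (integB mX (n_integ t_ge0) (QX_integ t)).
have gY'i := flow_gradient_integ mY agY t0 gY_lip gY_quot
  (integB mY (m_integ t_ge0) (QY_integ t)).
have near_fin : \forall s \near t, [/\ 0 < s, KLX s \is a fin_num & KLY s \is a fin_num].
  by apply: filterS3 (near_gt0 t0) nearX nearY => s s0 fX fY; split; [exact: s0|exact: fX|exact: fY].
pose IX := \int[leb]_(x in X) (gX' x * (n t x - QX t x)).
pose IY := \int[leb]_(y in Y) (gY' y * (m t y - QY t y)).
have IE (M : set 'rV[R]_d) (g' p q : 'rV[R]_d -> R) : measurable M ->
    leb.-integrable M (EFin \o (fun x => g' x * (p x - q x))) ->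
    \int[leb]_(x in M) (g' x * (alpha * (q x - p x))) =
    - alpha * \int[leb]_(x in M) (g' x * (p x - q x)).
  move=> mM gi; rewrite -RintegralZl//; apply: eq_Rintegral => x _; ring.
rewrite (IE _ _ _ _ mX gX'i) -/IX in crossX; rewrite (IE _ _ _ _ mY gY'i) -/IY in crossY.
(* Only the sum has a known sign: [- alpha] times it is a limit of nonpositive quotients, the
   velocities being [- alpha] times [n - Q] and [m - Q]. *)
have I_ge0 : 0 <= IX + IY.
  pose cr s := \int[leb]_(x in X) ((gX s x - gX t x) * (n s x - n t x)) +
    \int[leb]_(y in Y) ((gY s y - gY t y) * (m s y - m t y)).
  have cross : cr s / (s - t) ^+ 2 @[s --> t^'] --> - alpha * IX + - alpha * IY.
    have -> : (fun s => cr s / (s - t) ^+ 2) = (fun s =>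
      \int[leb]_(x in X) ((gX s x - gX t x) * (n s x - n t x)) / (s - t) ^+ 2 +
      \int[leb]_(y in Y) ((gY s y - gY t y) * (m s y - m t y)) / (s - t) ^+ 2).
      by apply/funext => s; rewrite -mulrDl.
    exact: (cvgD crossX crossY).
  have : - alpha * IX + - alpha * IY <= 0.
    rewrite -(cvg_lim _ cross)//; apply: limr_le.
      by apply/cvg_ex; exists (- alpha * IX + - alpha * IY); exact: cross.
    apply: nbhs_dnbhs; apply: filterS (near_gt0 t0) => s s0.
    apply: mulr_le0_ge0; last by rewrite invr_ge0 sqr_ge0.
    exact: (gradient_monotone (ltW s0) t_ge0).
  by rewrite -mulrDr mulNr oppr_le0 pmulr_rge0.
pose jX := \int[leb]_(x in X) ((n t x - QX t x) * ln (n t x / QX t x)).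
pose jY := \int[leb]_(y in Y) ((m t y - QY t y) * ln (m t y / QY t y)).
exists (jX + jY), ((- (alpha * jX) - IX) + (- (alpha * jY) - IY)); split.
- apply: filterS near_fin => s [s0 fX fY].
  by rewrite (LE (ltW s0)); move: fX fY; case: (KLX s) => //; case: (KLY s).
- apply: cvg_quotient_is_derive.
  have fine_L s : 0 <= s -> KLX s \is a fin_num -> KLY s \is a fin_num ->
      fine (L s) = fine (KLX s) + fine (KLY s).
    by move=> s0 fX fY; rewrite (LE s0) (fineD fX fY).
  have dXY : (fine (KLX s) + fine (KLY s) - (fine (KLX t) + fine (KLY t))) / (s - t)
      @[s --> t^'] --> - (alpha * jX) - IX + (- (alpha * jY) - IY).
    exact: (is_derive_quotient (is_deriveD dX dY)).
  apply: cvg_trans dXY; apply: near_eq_cvg; apply: nbhs_dnbhs.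
  apply: filterS near_fin => s [s0 fX fY].
  exact: (esym (congr2 (fun a b => (a - b) / (s - t)) (fine_L _ (ltW s0) fX fY)
    (fine_L _ t_ge0 KXfin KYfin))).
- have [KX KX'] := eq_KL_density mX (nuP t_ge0) (integ_measurable (QX_integ t)).
  have [KY KY'] := eq_KL_density mY (muP t_ge0) (integ_measurable (QY_integ t)).
  have JXE := etrans (congr2 (fun a b => a + b)%E KX KX') JX.
  have JYE := etrans (congr2 (fun a b => a + b)%E KY KY') JY.
  exact: (congr2 (fun a b => a + b)%E JXE JYE).
- by move: I_ge0; move: (alpha) (jX) (jY) (IX) (IY) => *; lra.
(* Jeffreys divergence exceeds the relative entropy by the reversed one, which is nonnegative. *)
- have nt0 x : X x -> 0 < n t x.
    by move=> Xx; exact: (flow_gt0 mX hUpi alpha_gt0 agX n_ge0 n_ode t0 Xx).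
  have mt0 y : Y y -> 0 < m t y.
    by move=> Yy; exact: (flow_gt0 mY hUrho alpha_gt0 agY m_ge0 m_ode t0 Yy).
  have KX' : (0 <= KL X (QX t) (n t))%E.
    apply: (KL_ge0 mX (QX_integ t) (n_integ t_ge0) (fun x _ => ltW (QX_gt0 t x)) nt0).
    by rewrite (n_int1 t_ge0) (best_response_int1 mX hUpi (agX t)).
  have KY' : (0 <= KL Y (QY t) (m t))%E.
    apply: (KL_ge0 mY (QY_integ t) (m_integ t_ge0) (fun y _ => ltW (QY_gt0 t y)) mt0).
    by rewrite (m_int1 t_ge0) (best_response_int1 mY hUrho (agY t)).
  have hX : (KLX t <= jX%:E)%E by rewrite -[jX%:E]JX; exact: leeDl KX'.
  have hY : (KLY t <= jY%:E)%E by rewrite -[jY%:E]JY; exact: leeDl KY'.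
  rewrite (LE t_ge0); apply: ge0_fine_le; last exact: (leeD hX hY).
  exact: (adde_ge0 (KLX_ge0 t_ge0) (KLY_ge0 t_ge0)).
Qed.

Lemma NI_le_KL_to_BR t : 0 <= t -> (L t < +oo)%E ->
  (NI sigma Upi Urho F (nu t) (mu t) <= (sigma ^+ 2 / 2)%:E * L t)%E.
Proof.
move=> t0 Lt; have [KXfin KYfin] := L_fin t0 Lt; rewrite (LE t0).
apply: (NI_le mX mY sigma_gt0 hUpi hUrho hF (agX t) (agY t) (nuP t0) (muP t0)).
- exact: fin_num_lty KXfin.
- exact: fin_num_lty KYfin.
Qed.

(** The bound tends to [L 0] as [s] tends to 0, which stands in for continuity there. Each player
    contributes [LL *+ 2] to the slope [A]. *)
Let L_initial : (L 0%R < +oo)%E -> exists A B : R, forall s, 0 < s ->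
  (L s <= (expR (- (alpha * s)) * (fine (L 0%R) + A * s) +
    (1 - expR (- (alpha * s))) * B)%:E)%E.
Proof.
move=> L0; have [KXfin KYfin] := L_fin (lexx 0) L0.
have KXoo := fin_num_lty KXfin.
have KYoo := fin_num_lty KYfin.
have [LL [LL0 gX_lip gY_lip]] := gradient_lipschitz (lexx 0).
have lipX s x : 0 <= s -> X x -> `|gX s x - gX 0 x| <= LL * s.
  by move=> s0 Xx; have := gX_lip s x s0 Xx; rewrite subr0 (ger0_norm s0).
have lipY s y : 0 <= s -> Y y -> `|gY s y - gY 0 y| <= LL * s.
  by move=> s0 Yy; have := gY_lip s y s0 Yy; rewrite subr0 (ger0_norm s0).
exists (LL *+ 4), (CX *+ 4 + CY *+ 4) => s s0.
set e := expR (- (alpha * s)).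
have hX : (KLX s <= (e * (fine (KLX 0) + LL * s *+ 2) + (1 - e) * (CX *+ 4))%:E)%E.
  exact: (flow_KL_initial mX hUpi alpha_gt0 agX n_integ n_int1 n_ge0 n_ode lipX KXoo s0).
have hY : (KLY s <= (e * (fine (KLY 0) + LL * s *+ 2) + (1 - e) * (CY *+ 4))%:E)%E.
  exact: (flow_KL_initial mY hUrho alpha_gt0 agY m_integ m_int1 m_ge0 m_ode lipY KYoo s0).
have L0E : fine (L 0) = fine (KLX 0) + fine (KLY 0).
  by rewrite (LE (lexx 0)) (fineD KXfin KYfin).
have sumE (a b r cx cy l : R) :
    r * (a + l * s *+ 2) + (1 - r) * (cx *+ 4) + (r * (b + l * s *+ 2) + (1 - r) * (cy *+ 4)) =
    r * (a + b + l *+ 4 * s) + (1 - r) * (cx *+ 4 + cy *+ 4).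
  by rewrite !mulrS !mulr0n; ring.
by rewrite (LE (ltW s0)) L0E -sumE; exact: (leeD hX hY).
Qed.

(** Finiteness has to precede monotonicity, since [KL_to_BR_derive] assumes it; [L_initial] provides
    it at all positive times. *)
Lemma KL_to_BR_decay t : (L 0%R < +oo)%E -> 0 <= t ->
  (L t <= (expR (- (alpha * t)))%:E * L 0%R)%E.
Proof.
move=> L0; have [A [B L_le]] := L_initial L0.
have L_ge0 s : 0 <= s -> (0 <= L s)%E.
  by move=> s0; rewrite LE// adde_ge0 ?KLX_ge0 ?KLY_ge0.
have Lfin s : 0 <= s -> L s \is a fin_num.
  move=> s0; rewrite (ge0_fin_numE (L_ge0 s s0)); move: s0; rewrite le_eqVlt => /predU1P[<-//|s0].
  by apply: le_lt_trans (L_le s s0) _; exact: ltry.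
rewrite le_eqVlt => /predU1P[<-|t0].
  by rewrite mulr0 oppr0 expR0 mul1e.
rewrite -(fineK (Lfin t (ltW t0))) -(fineK (Lfin 0 (lexx 0))) -EFinM lee_fin.
pose h s := expR (alpha * s) * fine (L s).
have dE (s : R) := is_derive_expR_scale alpha s.
have dh (s : R) : 0 < s -> exists2 l, is_derive s 1 h l & l <= 0.
  move=> s0; have Ls : (L s < +oo)%E by apply: fin_num_lty; apply: Lfin; exact: ltW.
  have [J [dL [_ dLs _ dLJ LJ]]] := KL_to_BR_derive s0 Ls.
  exists (expR (alpha * s) *: dL + fine (L s) *: (alpha * expR (alpha * s))).
    exact: is_deriveM.
  (* [fine (L s) <= J] turns the dissipation bound into [dL + alpha * fine (L s) <= 0]. *)
  have := ler_wpM2l (ltW alpha_gt0) LJ; move: (expR_ge0 (alpha * s)) dLJ.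
  rewrite /GRing.scale/=; move: (expR _) (fine _) => e l e0 dLJ lJ.
  have -> : e * dL + l * (alpha * e) = e * (dL + alpha * l) by ring.
  by rewrite mulr_ge0_le0//; lra.
have h_nincr s : 0 < s -> s <= t -> h t <= h s.
  move=> s0 st; apply: (@ler0_derive1_le_cc _ h s t) => //.
  - move=> r; rewrite in_itv/= => /andP[sr rt].
    by have [l dhl _] := dh r (lt_trans s0 sr); exact: ex_derive.
  - move=> r; rewrite in_itv/= => /andP[sr rt].
    by have [l dhl l0] := dh r (lt_trans s0 sr); rewrite derive1E derive_val.
  - apply: derivable_within_continuous => r; rewrite in_itv/= => /andP[sr rt].
    by have [l dhl _] := dh r (lt_le_trans s0 sr); exact: ex_derive.
  - by rewrite in_itv/= st lexx.
  - by rewrite in_itv/= st lexx.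
(* The bound of [L_initial] multiplied by [expR (alpha * s)]. It is continuous with value
   [fine (L 0)] at 0, a time that the monotonicity of [h] does not reach. *)
pose f s := fine (L 0) + A * s + (expR (alpha * s) - 1) * B.
have hf s : 0 < s -> h s <= f s.
  move=> s0; have := L_le s s0; rewrite -{1}(fineK (Lfin s (ltW s0))) lee_fin => Ls.
  have := ler_wpM2l (expR_ge0 (alpha * s)) Ls; rewrite -/(h s).
  suff -> : expR (alpha * s) * (expR (- (alpha * s)) * (fine (L 0) + A * s) +
    (1 - expR (- (alpha * s))) * B) = f s by [].
  have E : expR (alpha * s) * expR (- (alpha * s)) = 1 by rewrite -expRD subrr expR0.
  rewrite mulrDr !mulrA mulrBr mulr1 E mul1r.
  by rewrite /f; ring.
have f_cvg : f s @[s --> 0^'+] --> f 0.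
  apply: cvg_at_right_filter; apply: cvgD.
    apply: cvgD; first exact: cvg_cst.
    by apply: cvgM; [exact: cvg_cst|exact: cvg_id].
  apply: cvgM; last exact: cvg_cst.
  apply: cvgB; last exact: cvg_cst.
  apply: (@cvg_comp _ _ _ (fun s : R => alpha * s) expR _ (nbhs (alpha * 0))).
    by apply: cvgM; [exact: cvg_cst|exact: cvg_id].
  exact: continuous_expR.
have ht : h t <= f 0.
  rewrite -(cvg_lim _ f_cvg)//; apply: limr_ge; first by apply/cvg_ex; exists (f 0).
  near=> s; apply: (@le_trans _ _ (h s)); last by apply: hf; near: s; exact: nbhs_right_gt.
  apply: h_nincr; first by near: s; exact: nbhs_right_gt.
  by near: s; exact: nbhs_right_le.
move: ht; rewrite /f !mulr0 expR0 subrr mul0r !addr0 /h => ht.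
rewrite -(ler_pM2l (expR_gt0 (alpha * t))) mulrA -expRD subrr expR0 mul1r.
exact: ht.
Unshelve. all: by end_near. Qed.

End best_response_dynamics.

Theorem theorem2p3 (R : realType) (d : nat) (X Y : set 'rV[R]_d)
    (mX : measurable X) (mY : measurable Y)
    (Upi Urho : 'rV[R]_d -> R)
    (hUpi : is_potential X Upi) (hUrho : is_potential Y Urho)
    (sigma alpha : R) (sigma_gt0 : 0 < sigma) (alpha_gt0 : 0 < alpha)
    (F : prob_on X -> prob_on Y -> R)
    (dF_nu dF_mu : prob_on X -> prob_on Y -> 'rV[R]_d -> R)
    (d2F_nunu d2F_munu d2F_mumu d2F_numu :
       prob_on X -> prob_on Y -> 'rV[R]_d -> 'rV[R]_d -> R)
    (hdF : first_flat_derivatives F dF_nu dF_mu)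
    (hF : convex_concave F dF_nu dF_mu)
    (hdF_bounded : exists C_nu C_mu : R, [/\ 0 < C_nu, 0 < C_mu &
       forall nu mu x y, X x -> Y y ->
         `|dF_nu nu mu x| <= C_nu /\ `|dF_mu nu mu y| <= C_mu])
    (hd2F : second_flat_derivatives dF_nu dF_mu
       d2F_nunu d2F_munu d2F_mumu d2F_numu)
    (hd2F_bounded : exists C_nunu C_mumu C_numu C_munu : R,
       [/\ 0 < C_nunu, 0 < C_mumu, 0 < C_numu, 0 < C_munu &
       forall nu mu x y x' y', X x -> Y y -> X x' -> Y y' ->
         [/\ `|d2F_nunu nu mu x x'| <= C_nunu,
             `|d2F_mumu nu mu y y'| <= C_mumu,
             `|d2F_numu nu mu y x| <= C_numu &
             `|d2F_munu nu mu x y| <= C_munu]])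
    (nu : R -> prob_on X) (mu : R -> prob_on Y)
    (hflow : MFBR_flow sigma Upi Urho dF_nu dF_mu alpha nu mu) :
  let L (t : R) : \bar R :=
    KL_to_BR sigma Upi Urho dF_nu dF_mu (nu t) (mu t) in
  (forall t : R, 0 < t -> (L t < +oo)%E ->
    [/\ \forall s \near t, L s \is a fin_num,
        derivable (fun s => fine (L s)) t 1 &
        ((derive1 (fun s => fine (L s)) t)%:E <=
         - (alpha%:E *
            Jeffreys_to_BR sigma Upi Urho dF_nu dF_mu (nu t) (mu t)))%E]) /\
  ((L 0%R < +oo)%E ->
   forall (nus : prob_on X) (mus : prob_on Y),
     is_MNE sigma Upi Urho F nus mus ->
     forall t : R, 0 <= t ->
       (L t <= (expR (- (alpha * t)))%:E * L 0%R)%E /\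
       (NI sigma Upi Urho F (nu t) (mu t) <=
        (sigma ^+ 2 / 2 * expR (- (alpha * t)))%:E * L 0%R)%E).
Proof.
move=> L; have [n [m flow]] := hflow.
(* The uniform bounds quantify over points of both domains at once, so bounding the derivative of
   one player takes a point in the domain of the other. *)
have [x0 Xx0] := prob_on_nonempty (nu 0); have [y0 Yy0] := prob_on_nonempty (mu 0).
have nuP t : 0 <= t -> is_density (nu t) (n t) by move=> /flow[].
have muP t : 0 <= t -> is_density (mu t) (m t) by move=> /flow[].
have n_ode t x : 0 <= t -> X x -> derivative_ge0 (n ^~ x) t
    (alpha * (Psi sigma Upi dF_nu (nu t) (mu t) x - n t x)).
  by move=> /flow[_ _ + _]; exact.
have m_ode t y : 0 <= t -> Y y -> derivative_ge0 (m ^~ y) t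
    (alpha * (Phi sigma Urho dF_mu (nu t) (mu t) y - m t y)).
  by move=> /flow[_ _ _ +]; exact.
have [C_nu [C_mu [_ _ dFC]]] := hdF_bounded.
have dF_nuC a b x : X x -> `|dF_nu a b x| <= C_nu.
  by move=> Xx; case: (dFC a b x y0 Xx Yy0).
have dF_muC a b y : Y y -> `|dF_mu a b y| <= C_mu.
  by move=> Yy; case: (dFC a b x0 y Xx0 Yy).
have [Cnn [Cmm [Cnm [Cmn [Cnn0 Cmm0 Cnm0 Cmn0 d2FC]]]]] := hd2F_bounded.
have d2F_nunuC a b x x' : X x -> X x' -> `|d2F_nunu a b x x'| <= Cnn.
  by move=> Xx Xx'; case: (d2FC a b x y0 x' y0 Xx Yy0 Xx' Yy0).
have d2F_mumuC a b y y' : Y y -> Y y' -> `|d2F_mumu a b y y'| <= Cmm.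
  by move=> Yy Yy'; case: (d2FC a b x0 y x0 y' Xx0 Yy Xx0 Yy').
have d2F_numuC a b y x : Y y -> X x -> `|d2F_numu a b y x| <= Cnm.
  by move=> Yy Xx; case: (d2FC a b x y x y Xx Yy Xx Yy).
have d2F_munuC a b x y : X x -> Y y -> `|d2F_munu a b x y| <= Cmn.
  by move=> Xx Yy; case: (d2FC a b x y x y Xx Yy Xx Yy).
have decay := KL_to_BR_decay mX mY hUpi hUrho sigma_gt0 alpha_gt0 hdF hF
  (ltW Cnn0) (ltW Cmm0) (ltW Cnm0) (ltW Cmn0) dF_nuC dF_muC hd2F
  d2F_nunuC d2F_mumuC d2F_numuC d2F_munuC nuP muP n_ode m_ode.
split=> [t t0 Lt|L0 nus mus _ t t0].
  have [J [dL [near_fin dLt JE dLJ _]]] := KL_to_BR_derive mX mY hUpi hUrho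
    sigma_gt0 alpha_gt0 hdF hF (ltW Cnn0) (ltW Cmm0) (ltW Cnm0) (ltW Cmn0)
    dF_nuC dF_muC hd2F d2F_nunuC d2F_mumuC d2F_numuC d2F_munuC nuP muP n_ode m_ode t0 Lt.
  split; [exact: near_fin|exact: ex_derive|].
  by rewrite JE derive1E derive_val -EFinM -EFinN lee_fin.
have Lt := decay t L0 t0; split; first exact: Lt.
have Ltoo : (L t < +oo)%E.
  apply: (le_lt_trans Lt); move: L0; rewrite /L.
  by case: (KL_to_BR _ _ _ _ _ _ _) => [r _| |] //; [exact: ltry|
    rewrite mulrNy gtr0_sg ?expR_gt0// mul1e].
apply: (le_trans (NI_le_KL_to_BR mX mY hUpi hUrho sigma_gt0 hdF hF dF_nuC dF_muC nuP muP t0 Ltoo)).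
rewrite (EFinM (sigma ^+ 2 / 2)) -muleA; apply: lee_wpmul2l; last exact: Lt.
by rewrite lee_fin divr_ge0// sqr_ge0.
Qed.
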